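(* (a) Let $Y$ be a cubical cut and project set, and let $Y'$ be the cut and project set formed from the same data ($E$, $F_\pi$ and $s$) but with the canonical window in place of the cubical window, where $s$ is a regular point for both windows. If $Y$ is not linearly repetitive, then $Y'$ is not linearly repetitive. (b) The converse fails in general: there exist a cubical cut and project set $Y$ which is linearly repetitive and whose corresponding set $Y'$, formed from the same data ($E$, $F_\pi$ and $s$, with $s$ regular for both windows) but with the canonical window, is not linearly repetitive.
   Context: Cut and project sets. Let $1\le d<k$, let $E=\{(x,L(x)):x\in\mathbb{R}^d\}\subseteq\mathbb{R}^k$ with $L:\mathbb{R}^d\to\mathbb{R}^{k-d}$ linear (the physical space), and let $F_\pi\subseteq\mathbb{R}^k$ be a subspace complementary to $E$ (the internal space). Let $\pi:\mathbb{R}^k\to E$ be the projection onto $E$ with respect to $\mathbb{R}^k=E+F_\pi$; it is assumed that $\pi|_{\mathbb{Z}^k}$ is injective. Let $F_\rho=\{0\}\times\mathbb{R}^{k-d}$, and let $\rho:\mathbb{R}^k\to E$ and $\rho^*:\mathbb{R}^k\to F_\rho$ be the projections with respect to $\mathbb{R}^k=E+F_\rho$. Given a window $\mathcal{W}\subseteq F_\rho$, the strip is $\mathcal{S}=\mathcal{W}+E$, and for $s\in\mathbb{R}^k/\mathbb{Z}^k$ the $k$ to $d$ cut and project set is $Y=Y_s=\pi(\mathcal{S}\cap(\mathbb{Z}^k+s))\subseteq E$. The point $s$ (and the set $Y$) is regular if $(\mathbb{Z}^k+s)\cap\partial\mathcal{S}=\emptyset$; $Y$ is totally irrational if the image of $E$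 in $\mathbb{R}^k/\mathbb{Z}^k$ is dense; aperiodic if the only $x\in E$ with $Y+x=Y$ is $x=0$. The cubical window is $\mathcal{W}=\{\sum_{i=d+1}^k t_ie_i:0\le t_i<1\}$; the canonical window is the image under $\rho^*$ of the unit cube in $\mathbb{R}^k$. A cubical (resp. canonical) cut and project set is a regular, totally irrational, aperiodic cut and project set with the cubical (resp. canonical) window. Linear repetitivity. For $y\in Y$ let $\tilde y$ be the unique point of $\mathcal{S}\cap(\mathbb{Z}^k+s)$ with $\pi(\tilde y)=y$. Fix a bounded convex $\Omega\subseteq E$ containing a neighborhood of $0$ in $E$. The patch of size $r$ at $y\in Y$ is $P(y,r)=\{y'\in Y:\rho(\tilde{y'}-\tilde y)\in r\Omega\}$; patches $P(y_1,r)$ and $P(y_2,r)$ are equivalent if $P(y_1,r)=P(y_2,r)+y_1-y_2$. $Y$ is linearly repetitive if there is $C>0$ such that for every $r\ge1$ and every $y\in Y$, every ball of diameter $Cr$ in $E$ contains a point $y'\in Y$ with $P(y',r)$ equivalent to $P(y,r)$. (This property does not depend on the choice of $\Omega$.) *)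

(* Defs.v *)
From HB Require Import structures.
From mathcomp Require Import all_boot all_order all_algebra generic_quotient.
From mathcomp Require Import all_classical all_reals all_analysis.

Set Implicit Arguments.
Unset Strict Implicit.
Unset Printing Implicit Defensive.

Import Order.TTheory GRing.Theory Num.Theory.
Import numFieldNormedType.Exports.

Local Open Scope classical_set_scope.
Local Open Scope ring_scope.

Definition int_lattice (R : realType) (n : nat) : set 'rV[R]_n :=
  [set v | forall i, v 0 i \is a Num.int].
Arguments int_lattice : clear implicits.

Section Torus.
Variables (R : realType) (n : nat).

Definition int_congr : rel 'rV[R]_n := fun u v => `[< int_lattice R n (u - v) >].

Lemma int_congr_refl : reflexive int_congr.
Proof. by move=> u; apply/asboolP => i; rewrite subrr mxE rpred0. Qed.

Lemma int_congr_sym : symmetric int_congr.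
Proof.
move=> u v; apply/asboolP/asboolP => uv i.
  by rewrite -opprB mxE rpredN; apply: uv.
by rewrite -opprB mxE rpredN; apply: uv.
Qed.

Lemma int_congr_trans : transitive int_congr.
Proof.
move=> v u w /asboolP uv /asboolP vw; apply/asboolP => i.
by rewrite -(subrKA v) mxE rpredD ?uv ?vw.
Qed.

Canonical int_congr_equiv :=
  EquivRel int_congr int_congr_refl int_congr_sym int_congr_trans.

Definition torus : Type := quotient_topology {eq_quot int_congr_equiv}%qT.

HB.instance Definition _ := Topological.copy torus
  (quotient_topology {eq_quot int_congr_equiv}%qT).

Definition torus_proj : 'rV[R]_n -> torus :=
  (\pi_(quotient_topology {eq_quot int_congr_equiv}))%qT.

End Torus.
Arguments torus : clear implicits.

Lemma torus_projP (R : realType) (n : nat) (u v : 'rV[R]_n) :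
  torus_proj u = torus_proj v <-> int_lattice R n (u - v).
Proof.
split=> [/eqquotP/asboolP//|uv].
by apply/eqquotP/asboolP.
Qed.

Definition boundary (T : topologicalType) (A : set T) : set T :=
  closure A `\` interior A.

Definition euclidean_norm (R : realType) (n : nat) (v : 'rV[R]_n) : R :=
  Num.sqrt (\sum_i v 0 i ^+ 2).

Section PhysicalSpace.
Variables (R : realType) (d m : nat).

Definition graph_map (L : 'Hom('rV[R]_d, 'rV[R]_m)) (x : 'rV[R]_d) :
  'rV[R]_(d + m) := row_mx x (L x).

Definition vertical_map : 'rV[R]_m -> 'rV[R]_(d + m) := row_mx 0.

(* [linfun] is meaningful on linear maps only, and both maps are linear;
   see [physical_spaceP] and [vertical_spaceP]. *)
Definition physical_space (L : 'Hom('rV[R]_d, 'rV[R]_m)) :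
  {vspace 'rV[R]_(d + m)} := limg (linfun (graph_map L)).

Definition vertical_space : {vspace 'rV[R]_(d + m)} :=
  limg (linfun vertical_map).

Lemma physical_spaceP L v :
  reflect (exists x, v = graph_map L x) (v \in physical_space L).
Proof.
have lin : linear (graph_map L).
  by move=> a x y; rewrite /graph_map linearP scale_row_mx add_row_mx.
pose B := GRing.isLinear.Build R 'rV[R]_d 'rV[R]_(d + m) _ (graph_map L) lin.
pose f : {linear _ -> _} := HB.pack (graph_map L) B.
rewrite /physical_space; apply: (iffP memv_imgP) => [[x _ ->]|[x ->]].
  by exists x; rewrite (lfunE f).
by exists x; rewrite ?memvf// (lfunE f).
Qed.

Lemma vertical_spaceP v :
  reflect (exists t, v = vertical_map t) (v \in vertical_space).
Proof.
have lin : linear vertical_map.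
  by move=> a x y; rewrite /vertical_map scale_row_mx add_row_mx scaler0 addr0.
pose B := GRing.isLinear.Build R 'rV[R]_m 'rV[R]_(d + m) _ vertical_map lin.
pose f : {linear _ -> _} := HB.pack vertical_map B.
rewrite /vertical_space; apply: (iffP memv_imgP) => [[x _ ->]|[x ->]].
  by exists x; rewrite (lfunE f).
by exists x; rewrite ?memvf// (lfunE f).
Qed.

(* [daddv_pi U V] is the projection onto U along V only when U and V meet
   trivially. *)
Lemma physical_vertical_compl L :
  (physical_space L + vertical_space = fullv)%VS /\
  (physical_space L :&: vertical_space = 0)%VS.
Proof.
split; apply/eqP.
  rewrite eqEsubv subvf /=; apply/subvP => v _.
  rewrite -[v]hsubmxK; apply/memv_addP; exists (graph_map L (lsubmx v)).
    by apply/physical_spaceP; exists (lsubmx v).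
  exists (vertical_map (rsubmx v - L (lsubmx v))).
    by apply/vertical_spaceP; eexists.
  by rewrite /graph_map /vertical_map add_row_mx addr0 addrC subrK.
rewrite -subv0; apply/subvP => v; rewrite memv_cap memv0.
move=> /andP[/physical_spaceP[x ->] /vertical_spaceP[t /eq_row_mx[-> _]]].
by rewrite /graph_map linear0 row_mx0.
Qed.

End PhysicalSpace.
Arguments vertical_space : clear implicits.

Record cut_and_project_data (R : realType) (d m : nat) := CutAndProjectData {
  slope_map : 'Hom('rV[R]_d, 'rV[R]_m);
  internal_space : {vspace 'rV[R]_(d + m)};
  translation : torus R (d + m);
  physical_dim_gt0 : (0 < d)%N;
  codim_gt0 : (0 < m)%N;
  internal_span : (physical_space slope_map + internal_space = fullv)%VS;
  internal_direct : (physical_space slope_map :&: internal_space = 0)%VS;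
  lattice_inj : {in int_lattice R (d + m) &,
    injective (daddv_pi (physical_space slope_map) internal_space)} }.

Section CutAndProject.
Variables (R : realType) (d m : nat) (D : cut_and_project_data R d m).
Implicit Types (W Omega : set 'rV[R]_(d + m)) (x y v : 'rV[R]_(d + m)).

Definition phys : {vspace 'rV[R]_(d + m)} := physical_space (slope_map D).

Definition proj_pi : 'End('rV[R]_(d + m)) := daddv_pi phys (internal_space D).

Definition proj_rho : 'End('rV[R]_(d + m)) :=
  daddv_pi phys (vertical_space R d m).

Definition proj_rho_star : 'End('rV[R]_(d + m)) :=
  daddv_pi (vertical_space R d m) phys.

Definition cubical_window : set 'rV[R]_(d + m) :=
  @vertical_map R d m @` [set t : 'rV[R]_m | forall i, 0 <= t 0 i < 1].

(* With the half-open cube instead, the strip below has the same closure and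
   the same interior, so the cut and project set at a regular point is
   unchanged. *)
Definition canonical_window : set 'rV[R]_(d + m) :=
  proj_rho_star @` [set v : 'rV[R]_(d + m) | forall i, 0 <= v 0 i <= 1].

Definition strip W : set 'rV[R]_(d + m) :=
  [set w + x | w in W & x in [set` phys]].

Definition shifted_lattice : set 'rV[R]_(d + m) :=
  [set v | torus_proj v = translation D].

Definition cp_set W : set 'rV[R]_(d + m) :=
  proj_pi @` (strip W `&` shifted_lattice).

Definition regular_window W : Prop := shifted_lattice `&` boundary (strip W) = set0.

Definition totally_irrational : Prop :=
  dense ((@torus_proj R (d + m)) @` [set` phys] : set (torus R (d + m))).

Definition aperiodic W : Prop :=
  forall x, x \in phys -> [set y + x | y in cp_set W] = cp_set W -> x = 0.

Definition is_cubical : Prop :=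
  [/\ regular_window cubical_window, totally_irrational & aperiodic cubical_window].

(* The default value is irrelevant: a lift of [y] exists when [y] is in
   [cp_set W] and, by [lattice_inj], it is unique. *)
Definition lattice_lift W y : 'rV[R]_(d + m) :=
  xget 0 [set z | (strip W `&` shifted_lattice) z /\ proj_pi z = y].

Lemma lattice_lift_unique y z1 z2 : shifted_lattice z1 -> shifted_lattice z2 ->
  proj_pi z1 = y -> proj_pi z2 = y -> z1 = z2.
Proof.
move=> sz1 sz2 z1y z2y; apply/eqP; rewrite -subr_eq0; apply/eqP.
apply: (lattice_inj (c := D)); rewrite ?inE.
- by apply/torus_projP; rewrite sz1 sz2.
- by move=> i; rewrite mxE rpred0.
- by move: z1y z2y; rewrite /proj_pi /phys linearB linear0/= => -> ->; rewrite subrr.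
Qed.

Definition patch_shape Omega : Prop :=
  [/\ Omega `<=` [set` phys], bounded_set Omega,
      @convex_set R 'rV[R]_(d + m) Omega &
      within [set` phys] (nbhs (0 : 'rV[R]_(d + m))) Omega].

Definition patch W Omega y (r : R) : set 'rV[R]_(d + m) :=
  [set y' | cp_set W y' /\
    [set r *: u | u in Omega] (proj_rho (lattice_lift W y' - lattice_lift W y))].

Definition patch_equiv W Omega (r : R) y1 y2 : Prop :=
  patch W Omega y1 r = [set y + y1 - y2 | y in patch W Omega y2 r].

(* [l] is the diameter, not the radius. *)
Definition phys_ball x (l : R) : set 'rV[R]_(d + m) :=
  [set y | y \in phys /\ euclidean_norm (y - x) < l / 2].

Definition linearly_repetitive W Omega : Prop :=
  exists2 C : R, 0 < C &
    forall (r : R) y, 1 <= r -> cp_set W y ->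
    forall x, x \in phys ->
    exists y', [/\ cp_set W y', phys_ball x (C * r) y' &
                   patch_equiv W Omega r y' y].

End CutAndProject.
Arguments cubical_window : clear implicits.

(* Main.v *)
Require Import Defs.
From mathcomp Require Import all_boot all_order all_algebra.
From mathcomp Require Import all_classical all_reals all_analysis.
From mathcomp Require Import ring lra.

(* (a) The closed cubical window is the intersection of the translates of the
   canonical window by the vectors - rho*(p, 0), p in {0, 1}^d: the coordinate
   [i] is cut at 0, resp. 1, by the vertex [p] that makes it extremal.  Hence a
   patch of size [r + c] of the canonical set determines the patch of size [r]
   of the cubical set.

   (b) In R^2 x R^2 let the two coordinates of the height of (p, q) be
   q1 + sqrt2 p1 and q2 + p1 + sqrt3 p2.  Since q2 + p1 is an arbitrary
   integer, the cubical set is a product of two Sturmian sequences of badly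
   approximable slope and is linearly repetitive.  The canonical window is a
   hexagon with a pair of sides on which ht1 - sqrt2 ht2 is constant; that
   form takes on the lattice the values q1 - sqrt2 q2 - sqrt2 sqrt3 p2, a rank
   three group, so by pigeonhole some patches of size O(N) force ht1 into an
   interval of length N^-2.  Linear repetitivity would make such a patch recur
   with p1 shifted by a nonzero O(N), whereas |q + sqrt2 p| >= c / |p|. *)

Set Implicit Arguments.
Unset Strict Implicit.
Unset Printing Implicit Defensive.

Import Order.TTheory GRing.Theory Num.Theory.
Import numFieldNormedType.Exports.

Local Open Scope classical_set_scope.
Local Open Scope ring_scope.

(** * Heights and patches *)

Section General.
Context {R : realType} {d m : nat} (D : cut_and_project_data R d m).
Implicit Types (W Omega : set 'rV[R]_(d + m)) (y z v n : 'rV[R]_(d + m)).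

Notation L := (slope_map D).
Notation vert := (@vertical_map R d m).

(** The coordinates of the projection of [v] to the vertical space along E. It vanishes on E, so it
    alone decides membership in a strip. *)
Definition height v : 'rV[R]_m := rsubmx v - L (lsubmx v).

Lemma heightD v w : height (v + w) = height v + height w.
Proof. by rewrite /height !linearD/=; apply/rowP => i; rewrite !mxE; ring. Qed.

Lemma heightB v w : height (v - w) = height v - height w.
Proof. by rewrite /height !linearB/=; apply/rowP => i; rewrite !mxE; ring. Qed.

Lemma graph_map_phys x : graph_map L x \in phys D.
Proof. by apply/physical_spaceP; exists x. Qed.

Lemma height_phys v : v \in phys D -> height v = 0.
Proof.
by move=> /physical_spaceP[x ->]; rewrite /height/graph_map row_mxKr row_mxKl subrr.
Qed.

Lemma height_vertical t : height (vert t) = t.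
Proof. by rewrite /height /vertical_map row_mxKr row_mxKl linear0 subr0. Qed.

Lemma graph_vertical v :
  v = graph_map L (lsubmx v) + vert (height v).
Proof.
rewrite /graph_map /vertical_map /height add_row_mx addr0 addrC.
by rewrite -{1}[v]hsubmxK addrNK.
Qed.

Lemma proj_rhoE v : proj_rho D v = graph_map L (lsubmx v).
Proof.
have [_ cap0] := physical_vertical_compl L.
have capC : (vertical_space R d m :&: physical_space L = 0)%VS by rewrite capvC.
have hv t : vert t \in vertical_space R d m by apply/vertical_spaceP; exists t.
rewrite {1}(graph_vertical v) linearD/= /proj_rho daddv_pi_id ?graph_map_phys//.
set w := vertical_map _ _.
have := daddv_pi_add (w := w) cap0; rewrite (physical_vertical_compl L).1 memvf.
rewrite (daddv_pi_id capC (hv _)) => /(_ isT) e.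
suff -> : daddv_pi (phys D) (vertical_space R d m) w = 0 by rewrite addr0.
by apply: (addIr w); rewrite add0r.
Qed.

Lemma proj_rho_starE v : proj_rho_star D v = vert (height v).
Proof.
have [span cap0] := physical_vertical_compl L.
have := daddv_pi_add (w := v) cap0; rewrite span memvf => /(_ isT).
have := proj_rhoE v; rewrite /proj_rho /proj_rho_star /phys => ->.
by move=> e; apply: (addrI (graph_map L (lsubmx v))); rewrite e -graph_vertical.
Qed.

Lemma strip_vertical W (A : set 'rV[R]_m) v :
  W = vert @` A -> strip D W v <-> A (height v).
Proof.
move=> ->; split => [[_ [t At <-]] [x xE <-]|Av].
  by rewrite heightD height_vertical (height_phys xE) addr0.
exists (vert (height v)); first by exists (height v).
exists (graph_map L (lsubmx v)); first exact: graph_map_phys.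
by rewrite addrC -graph_vertical.
Qed.

Lemma strip_cubicalP v : strip D (cubical_window R d m) v <->
  forall i, 0 <= height v 0 i < 1.
Proof. by rewrite (strip_vertical _ erefl). Qed.

Lemma strip_canonicalP v : strip D (canonical_window D) v <->
  exists2 u : 'rV[R]_(d + m), (forall i, 0 <= u 0 i <= 1) & height v = height u.
Proof.
rewrite (@strip_vertical _ [set height u |
  u in [set u : 'rV[R]_(d + m) | forall i, 0 <= u 0 i <= 1]]).
  by split=> [[u hu <-]|[u hu ->]]; exists u.
apply/seteqP; split => [_ [u hu <-]|_ [_ [u hu <-]] <-].
  by exists (height u); [exists u|rewrite proj_rho_starE].
by exists u => //; rewrite proj_rho_starE.
Qed.

Lemma strip_cubical_canonical v :
  strip D (cubical_window R d m) v -> strip D (canonical_window D) v.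
Proof.
move=> /strip_cubicalP hv; apply/strip_canonicalP.
exists (vert (height v)); last by rewrite height_vertical.
move=> i; rewrite /vertical_map; case: (split_ordP i) => j ->.
  by rewrite row_mxEl mxE lexx ler01.
by rewrite row_mxEr; have /andP[-> /ltW] := hv j.
Qed.

Lemma shifted_latticeD z n : shifted_lattice D z ->
  shifted_lattice D (z + n) <-> int_lattice R (d + m) n.
Proof.
have {2}<- : (z + n) - z = n by rewrite addrC addKr.
by rewrite -torus_projP /shifted_lattice/= => <-.
Qed.

Lemma shifted_latticeB z1 z2 : shifted_lattice D z1 -> shifted_lattice D z2 ->
  int_lattice R (d + m) (z1 - z2).
Proof. by move=> s1 s2; apply/torus_projP; rewrite s1 s2. Qed.

Lemma lattice_liftP W y (z := lattice_lift D W y) : cp_set D W y ->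
  [/\ strip D W z, shifted_lattice D z & proj_pi D z = y].
Proof.
move=> [z' Sz' zy]; rewrite /z /lattice_lift.
case: xgetP => [? -> [[? ?] ?]//|/(_ z')] []; split => //.
Qed.

Lemma lattice_lift_proj W z : strip D W z -> shifted_lattice D z ->
  lattice_lift D W (proj_pi D z) = z.
Proof.
move=> Sz sz.
have [|_ s1 e1] := @lattice_liftP W (proj_pi D z); first by exists z.
exact: (lattice_lift_unique s1 sz e1).
Qed.

Lemma cp_set_proj W z : shifted_lattice D z ->
  cp_set D W (proj_pi D z) <-> strip D W z.
Proof.
move=> sz; split => [yW|Sz]; last by exists z.
have [S s e] := lattice_liftP yW.
by rewrite -(lattice_lift_unique s sz e erefl).
Qed.

(** Injectivity of pi on the lattice lets every point of the set near [proj_pi D z] be written as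
    [proj_pi D (z + n)] for one lattice vector [n]. This removes pi: equivalence of patches becomes
    equality of strip membership after each displacement [n]. *)
Lemma patch_equivP W Omega (r : R) z1 z2 :
    shifted_lattice D z1 -> shifted_lattice D z2 ->
    strip D W z1 -> strip D W z2 ->
  patch_equiv D W Omega r (proj_pi D z1) (proj_pi D z2) <->
  forall n, int_lattice R (d + m) n -> [set r *: u | u in Omega] (proj_rho D n) ->
    strip D W (z1 + n) <-> strip D W (z2 + n).
Proof.
move=> s1 s2 S1 S2.
have patchE z n : shifted_lattice D z -> strip D W z -> int_lattice R (d + m) n ->
    Defs.patch D W Omega (proj_pi D z) r (proj_pi D (z + n)) <->
    strip D W (z + n) /\ [set r *: u | u in Omega] (proj_rho D n).
  move=> s S nZ; have sn : shifted_lattice D (z + n) by apply/shifted_latticeD.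
  split=> [[/(cp_set_proj W sn) Sn]|[Sn nO]].
    by rewrite !lattice_lift_proj// addrC addKr.
  split; first by apply/cp_set_proj.
  by rewrite !lattice_lift_proj// addrC addKr.
have trans n : proj_pi D (z1 + n) = proj_pi D (z2 + n) + proj_pi D z1 - proj_pi D z2.
  by rewrite !linearD/= [RHS]addrC -!addrA addKr addrC.
rewrite /patch_equiv; split => [eqP n nZ nO|eqS].
  split=> S.
    have : Defs.patch D W Omega (proj_pi D z1) r (proj_pi D (z1 + n)).
      by apply/patchE.
    rewrite eqP => -[y yP].
    rewrite trans => /addIr/addIr ey; move: yP; rewrite ey.
    by move=> /(patchE _ _ s2 S2 nZ)[].
  have : Defs.patch D W Omega (proj_pi D z1) r (proj_pi D (z1 + n)).
    by rewrite eqP trans; exists (proj_pi D (z2 + n)) => //; apply/patchE.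
  by move=> /(patchE _ _ s1 S1 nZ)[].
have cpE z y : shifted_lattice D z -> cp_set D W y ->
    exists2 n, int_lattice R (d + m) n & y = proj_pi D (z + n).
  move=> s /lattice_liftP; set w := lattice_lift _ _ _ => -[_ sw <-].
  exists (w - z); last by rewrite addrC subrK.
  exact: shifted_latticeB.
apply/seteqP; split=> y.
  move=> yP; have [n nZ ey] := cpE _ _ s1 yP.1.
  move: yP; rewrite ey => /(patchE _ _ s1 S1 nZ)[Sn nO].
  exists (proj_pi D (z2 + n)); last by rewrite -trans.
  by apply/patchE => //; split => //; apply/eqS.
move=> [y' yP <-]; have [n nZ ey] := cpE _ _ s2 yP.1.
move: yP; rewrite ey => /(patchE _ _ s2 S2 nZ)[Sn nO].
by rewrite -trans; apply/patchE => //; split => //; apply/eqS.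
Qed.

Lemma proj_pi_phys v : proj_pi D v \in phys D.
Proof. exact: memv_pi. Qed.

End General.

(** * The cubical set from the canonical one *)

Lemma coord_norm_le (R : realType) n (v : 'rV[R]_n) i : `|v 0 i| <= `|v|.
Proof.
by rewrite {2}/Num.norm/= mx_normrE; apply: (le_bigmax _ _ (0, i)).
Qed.

Lemma norm_le_coord (R : realType) n (v : 'rV[R]_n) (c : R) : 0 <= c ->
  (forall i, `|v 0 i| <= c) -> `|v| <= c.
Proof.
move=> c0 vc; rewrite /Num.norm/= mx_normrE; apply: bigmax_le => // -[i j] _.
by rewrite ord1.
Qed.

Lemma linear_norm_le (R : realType) n k (f : 'Hom('rV[R]_n, 'rV[R]_k)) :
  exists2 K : R, 0 < K & forall v, `|f v| <= K * `|v|.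
Proof.
pose S := \sum_(i < n) `|f (delta_mx 0 i)|.
have S0 : 0 <= S by apply: sumr_ge0.
exists (S + 1) => [|v]; first by lra.
apply: (@le_trans _ _ (S * `|v|)); last by rewrite ler_wpM2r//; lra.
rewrite {1}[v]row_sum_delta linear_sum mulr_suml.
apply: le_trans (ler_norm_sum _ _ _) _; apply: ler_sum => i _.
by rewrite linearZ/= normrZ mulrC ler_wpM2l// coord_norm_le.
Qed.

Lemma euclidean_norm_le (R : realType) n (v : 'rV[R]_n) (c : R) : 0 <= c ->
  (forall i, `|v 0 i| <= c) -> euclidean_norm v <= n%:R * c.
Proof.
move=> c0 vc; have nc0 : 0 <= n%:R * c by rewrite mulr_ge0.
rewrite /euclidean_norm -[leRHS]ger0_norm// -sqrtr_sqr ler_sqrt ?sqr_ge0//.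
apply: (@le_trans _ _ (\sum_(i < n) c ^+ 2)).
  by apply: ler_sum => i _; rewrite -[v 0 i ^+ 2]real_normK ?num_real// lerXn2r ?nnegrE.
rewrite sumr_const card_ord exprMn -[_ *+ n]mulr_natl ler_wpM2r ?sqr_ge0//.
by rewrite -natrX ler_nat; case: n {v vc nc0} => // n; rewrite expnS expn1 leq_pmulr.
Qed.

Lemma coord_euclidean_norm_le (R : realType) n (v : 'rV[R]_n) i :
  `|v 0 i| <= euclidean_norm v.
Proof.
rewrite /euclidean_norm -sqrtr_sqr ler_sqrt; last by apply: sumr_ge0 => *; apply: sqr_ge0.
by rewrite (bigD1 i)//= lerDl sumr_ge0// => *; apply: sqr_ge0.
Qed.

(** * Bounds and convexity of patch shapes *)

Section PatchShape.
Context {R : realType} {d m : nat} (D : cut_and_project_data R d m).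
Variables (Omega : set 'rV[R]_(d + m)) (shape : patch_shape D Omega).

Lemma patch_shape_nbhs0 : exists2 e : R, 0 < e &
  forall v, v \in phys D -> (forall i, `|v 0 i| < e) -> Omega v.
Proof.
have [_ _ _] := shape; rewrite /within/= => /nbhs_ballP[e /= e0 eO].
exists e => // v vE ve; apply: eO => //; split => // i j.
by rewrite ord1 /ball/= mxE sub0r normrN.
Qed.

Lemma patch_shape_bounded : exists2 M : R, 0 < M &
  forall v i, Omega v -> `|v 0 i| <= M.
Proof.
have [_ /pinfty_ex_gt0[M M0 OM] _ _] := shape.
by exists M => // v i /OM; apply: le_trans; apply: coord_norm_le.
Qed.

(** Convexity gives [a Omega + b Omega] inside [(a + b) Omega], so patch sizes add when
    displacements are added. *)
Lemma patch_shape_conv (a b : R) u v : 0 <= a -> 0 <= b -> 0 < a + b ->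
  Omega u -> Omega v ->
  [set (a + b) *: w | w in Omega] (a *: u + b *: v).
Proof.
move=> a0 b0 ab0 Ou Ov.
have t01 : 0 <= a / (a + b) <= 1.
  by rewrite divr_ge0 ?(ltW ab0)//= ler_pdivrMr// mul1r lerDl.
have [_ _ cvx _] := shape.
have := cvx u v (Itv01 (andP t01).1 (andP t01).2).
rewrite !inE => /(_ Ou Ov); rewrite /conv/= => Ow.
eexists; first exact: Ow.
rewrite /= scalerDr !scalerA; congr (_ *: _ + _ *: _); rewrite /unstable.onem; field; lra.
Qed.

End PatchShape.

(** * The cubical window as an intersection of translates *)

Section CubicalFromCanonical.
Context {R : realType} {d m : nat} (D : cut_and_project_data R d m).
Implicit Types (z v n : 'rV[R]_(d + m)).

Notation L := (slope_map D).
Notation cubical := (cubical_window R d m).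
Notation canonical := (canonical_window D).

(** Scaling the height by [1 - t] moves the closed cube into the half-open one, so [z] lies in the
    closure of the strip; were it outside the strip it would be a boundary point, against
    regularity. *)
Lemma regular_cubical_closed z : regular_window D cubical ->
  shifted_lattice D z -> (forall i, 0 <= height D z 0 i <= 1) ->
  strip D cubical z.
Proof.
move=> reg sz hz; apply: contrapT => nS.
suff : (shifted_lattice D `&` Defs.boundary (strip D cubical)) z by rewrite reg.
split => //; split; last by move=> /interior_subset.
move=> B /nbhs_ballP[e /= e0 eB].
have [w wE] : exists w, w = vertical_map d (height D z) by eexists.
pose t := Num.min (1 / 2) (e / 2 / (1 + `|w|)).
have w1 : 0 < 1 + `|w| by rewrite ltr_pwDl.
have t0 : 0 < t by rewrite /t lt_min !divr_gt0.
have tw : t * `|w| < e.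
  apply: (@le_lt_trans _ _ (e / 2 / (1 + `|w|) * `|w|)).
    by rewrite ler_wpM2r// ge_min lexx orbT.
  rewrite mulrAC ltr_pdivrMr//; nra.
have t2 : t <= 1 / 2 by rewrite ge_min lexx.
exists (z - t *: w); split; last first.
  apply: eB; split => // i j; rewrite ord1 /ball/= !mxE opprB addrC subrK normrM.
  rewrite (gtr0_norm t0); apply: le_lt_trans tw.
  by rewrite ler_wpM2l ?(ltW t0)// coord_norm_le.
apply/strip_cubicalP => i.
have -> : height D (z - t *: w) = (1 - t) *: height D z.
  rewrite heightB; have -> : t *: w = vertical_map d (t *: height D z).
    by rewrite wE /vertical_map scale_row_mx scaler0.
  by rewrite height_vertical scalerBl scale1r.
by rewrite mxE; have /andP[h0 h1] := hz i; nra.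
Qed.

Definition vertex (b : {ffun 'I_d -> bool}) : 'rV[R]_(d + m) :=
  row_mx (\row_j (b j)%:R) 0.

Lemma vertex_int b : int_lattice R (d + m) (vertex b).
Proof.
move=> i; rewrite /vertex; case: (split_ordP i) => j ->.
  by rewrite row_mxEl mxE; case: (b j).
by rewrite row_mxEr mxE.
Qed.

Lemma height_coord v i : height D v 0 i =
  v 0 (rshift d i) - \sum_j v 0 (lshift m j) * L (delta_mx 0 j) 0 i.
Proof.
rewrite /height !mxE; congr (_ - _).
rewrite {1}[lsubmx v]row_sum_delta linear_sum summxE.
by apply: eq_bigr => j _; rewrite linearZ/= !mxE.
Qed.

(* The vertex [b] of the unit cube of R^d where the [i]th coordinate of the
   height is extremal carries a translate of the cubical window to the
   corresponding side of the canonical one. *)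
Lemma strip_cubical_vertex z : regular_window D cubical ->
  shifted_lattice D z ->
  strip D cubical z <-> forall b, strip D canonical (z + vertex b).
Proof.
move=> reg sz; split => [/strip_cubicalP hz b|hz].
  apply/strip_canonicalP; exists (vertical_map d (height D z) + vertex b).
    move=> i; rewrite /vertical_map /vertex add_row_mx addr0 add0r.
    case: (split_ordP i) => j ->.
      by rewrite row_mxEl mxE; case: (b j); rewrite /= ?lexx ler01.
    by rewrite row_mxEr; have /andP[-> /ltW] := hz j.
  by rewrite !heightD height_vertical.
apply: regular_cubical_closed => // i.
pose c j := L (delta_mx 0 j) 0 i.
have vE (b : {ffun 'I_d -> bool}) : height D (vertex b) 0 i = - \sum_j (b j)%:R * c j.
  rewrite height_coord /vertex row_mxEr mxE sub0r; congr (- _).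
  by apply: eq_bigr => j _; rewrite row_mxEl mxE.
apply/andP; split.
  (* Lower bound: the vertex that selects the nonnegative [c j] maximises the sum of the [u j * c j]
     over the cube. For the upper bound below, selecting the negative ones minimises it. *)
  have /strip_canonicalP[u hu] := hz [ffun j => c j >= 0].
  move=> /(congr1 (fun v : 'rV_m => v 0 i)); rewrite heightD mxE vE height_coord => e.
  have /andP[u0 _] := hu (rshift d i).
  suff : \sum_j u 0 (lshift m j) * c j <= \sum_j ([ffun j => c j >= 0] j)%:R * c j.
    by rewrite /c in e *; lra.
  apply: ler_sum => j _; rewrite ffunE.
  have /andP[a0 a1] := hu (lshift m j).
  by case: (leP 0 (c j)) => cj; rewrite ?mul1r ?mul0r; nra.
have /strip_canonicalP[u hu] := hz [ffun j => c j < 0].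
move=> /(congr1 (fun v : 'rV_m => v 0 i)); rewrite heightD mxE vE height_coord => e.
have /andP[_ u1] := hu (rshift d i).
suff : \sum_j u 0 (lshift m j) * c j >= \sum_j ([ffun j => c j < 0] j)%:R * c j.
  by rewrite /c in e *; lra.
apply: ler_sum => j _; rewrite ffunE.
have /andP[a0 a1] := hu (lshift m j).
by case: (ltP (c j) 0) => cj; rewrite ?mul1r ?mul0r; nra.
Qed.

Lemma phys_ballS x (l l' : R) : l <= l' -> phys_ball D x l `<=` phys_ball D x l'.
Proof. by move=> ll' y [yE yl]; split => //; apply: lt_le_trans yl _; lra. Qed.

Lemma vertex_patch (Omega : set 'rV[R]_(d + m)) : patch_shape D Omega ->
  exists2 c : R, 0 < c &
    forall b, [set c *: u | u in Omega] (proj_rho D (vertex b)).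
Proof.
move=> shape; have [e e0 eO] := patch_shape_nbhs0 shape.
pose K := \sum_(b : {ffun 'I_d -> bool}) `|proj_rho D (vertex b)|.
have K0 : 0 <= K by apply: sumr_ge0.
have c0 : 0 < (K + 1) / e by rewrite divr_gt0// ltr_wpDl.
exists ((K + 1) / e) => // b.
exists (((K + 1) / e)^-1 *: proj_rho D (vertex b)); last first.
  by rewrite scalerA divff ?scale1r// gt_eqF.
apply: eO; first by rewrite memvZ// proj_rhoE graph_map_phys.
move=> i; rewrite mxE normrM gtr0_norm ?invr_gt0// mulrC ltr_pdivrMr//.
rewrite mulrC -mulrA mulVf ?gt_eqF// mulr1.
apply: (@le_lt_trans _ _ K); last by rewrite ltrDl.
apply: le_trans (coord_norm_le _ _) _.
by rewrite /K (bigD1 b)//= lerDl sumr_ge0.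
Qed.

(** Recurrence of canonical patches of size [r + c] is transferred to cubical patches of size [r],
    where [c] absorbs the vertex displacements. The constant [C * (1 + c)] suffices because
    [r + c <= (1 + c) * r] for [r >= 1]. *)
Lemma linearly_repetitive_cubical (Omega : set 'rV[R]_(d + m)) :
  patch_shape D Omega -> regular_window D cubical ->
  linearly_repetitive D canonical Omega ->
  linearly_repetitive D cubical Omega.
Proof.
move=> shape reg [C C0 rep]; have [c c0 cO] := vertex_patch shape.
exists (C * (1 + c)); first by rewrite mulr_gt0// addr_gt0.
move=> r y r1 yY x xE.
have [S sz <-] := lattice_liftP yY; set z := lattice_lift _ _ _ in S sz *.
have S' := strip_cubical_canonical S.
have zY' : cp_set D canonical (proj_pi D z) by apply/cp_set_proj.
have rc1 : 1 <= r + c by lra.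
have [y' [y'Y' y'x]] := rep (r + c) _ rc1 zY' x xE.
have [T tz <-] := lattice_liftP y'Y'; set t := lattice_lift _ _ _ in T tz *.
move=> /(patch_equivP _ _ tz sz T S') eqv.
have O0 : Omega 0.
  by have [e e0] := patch_shape_nbhs0 shape; apply => [|i]; rewrite ?mem0v// mxE normr0.
have vO b : [set (r + c) *: u | u in Omega] (proj_rho D (vertex b)).
  have [u Ou <-] := cO b.
  have := patch_shape_conv shape (a := r) (b := c) (u := 0) (v := u).
  by rewrite scaler0 add0r; apply=> //; lra.
(* The canonical patches at [t] and [z] agree at every vertex displacement, so [t] inherits
   membership in the cubical strip from [z]. *)
have Tc : strip D cubical t.
  apply/strip_cubical_vertex => // b; apply/eqv => //; first exact: vertex_int.
  exact: (strip_cubical_vertex reg sz).1.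
exists (proj_pi D t); split.
- exact/cp_set_proj.
- have Cc : 0 <= C * c * (r - 1) by apply: mulr_ge0; [apply: mulr_ge0; exact: ltW|rewrite subr_ge0].
  have /phys_ballS : C * (r + c) <= C * (1 + c) * r by nra.
  by apply; have [_ _ ->] := lattice_liftP y'Y'.
apply/patch_equivP => // n nZ [u Ou nE].
rewrite !strip_cubical_vertex ?shifted_latticeD//.
split=> H b; have := H b; rewrite -!addrA; apply eqv.
- by move=> i; rewrite mxE rpredD ?nZ ?vertex_int.
- rewrite linearD/= -nE; have [v Ov <-] := cO b.
  by apply: (patch_shape_conv shape) => //; lra.
- by move=> i; rewrite mxE rpredD ?nZ ?vertex_int.
- rewrite linearD/= -nE; have [v Ov <-] := cO b.
  by apply: (patch_shape_conv shape) => //; lra.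
Qed.

End CubicalFromCanonical.

(** * Badly approximable numbers *)

(** If [b] were nonzero, the exponents of [p] in the two sides would have opposite parity. *)
Lemma sqr_eq_mul_sqr (p D : nat) (a b : int) : prime p -> odd (logn p D) ->
  a ^+ 2 = D%:Z * b ^+ 2 -> a = 0 /\ b = 0.
Proof.
move=> pp oD e.
have D0 : (0 < D)%N by rewrite lt0n; apply: contraTneq oD => ->; rewrite logn0.
have en : (`|a| ^ 2 = D * `|b| ^ 2)%N.
  by have := congr1 absz e; rewrite abszM !abszX.
have b0 : b = 0.
  apply/eqP; rewrite -absz_eq0; apply: contraT; rewrite -lt0n => b0.
  have := congr1 (odd \o logn p) en => /=.
  by rewrite lognM ?expn_gt0 ?b0// oddD !lognX !oddM /= oD.
split=> //; move: e; rewrite b0 expr0n mulr0 => /eqP.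
by rewrite expf_eq0 => /eqP.
Qed.

Section Approximation.
Context {R : realType}.

Lemma sqrt_irrational (p D : nat) (a b : int) : prime p -> odd (logn p D) ->
  a%:~R + Num.sqrt (D%:R : R) * b%:~R = 0 -> a = 0 /\ b = 0.
Proof.
move=> pp oD e; apply: (sqr_eq_mul_sqr pp oD); apply/eqP.
rewrite -(eqr_int R) !rmorphXn/= rmorphM/= rmorphXn/= -pmulrn.
have -> : a%:~R = - (Num.sqrt (D%:R : R) * b%:~R) by apply/eqP; rewrite -addr_eq0 e.
by rewrite sqrrN exprMn sqr_sqrtr ?ler0n.
Qed.

Notation sqrt2 := (Num.sqrt (2%:R : R)).
Notation sqrt3 := (Num.sqrt (3%:R : R)).

Lemma sqr_sqrt2 : sqrt2 ^+ 2 = 2. Proof. by rewrite sqr_sqrtr. Qed.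
Lemma sqr_sqrt3 : sqrt3 ^+ 2 = 3. Proof. by rewrite sqr_sqrtr. Qed.
Lemma sqrt2_gt0 : 0 < sqrt2. Proof. by rewrite sqrtr_gt0. Qed.
Lemma sqrt3_gt0 : 0 < sqrt3. Proof. by rewrite sqrtr_gt0. Qed.

Lemma sqrt2_irrational (a b : int) : a%:~R + sqrt2 * b%:~R = 0 -> a = 0 /\ b = 0.
Proof. exact: (@sqrt_irrational 2). Qed.

Lemma sqrt3_irrational (a b : int) : a%:~R + sqrt3 * b%:~R = 0 -> a = 0 /\ b = 0.
Proof. exact: (@sqrt_irrational 3). Qed.

(* Squaring [a = - sqrt2 (b + c sqrt3)] turns the relation into one between 1
   and [sqrt3], namely [a^2 = 2 b^2 + 6 c^2 + 4 b c sqrt3]. *)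
Lemma sqrt26_independent (a b c : int) :
  a%:~R + sqrt2 * b%:~R + sqrt2 * sqrt3 * c%:~R = 0 -> [/\ a = 0, b = 0 & c = 0].
Proof.
move=> e.
have e2 : (2 * b ^+ 2 + 6 * c ^+ 2 - a ^+ 2)%:~R + sqrt3 * (4 * b * c)%:~R = 0.
  rewrite !(intrB, intrD, intrM).
  have -> : a%:~R = - (sqrt2 * (b%:~R + sqrt3 * c%:~R)) by lra.
  transitivity ((2 - sqrt2 ^+ 2) * (b%:~R + sqrt3 * c%:~R) ^+ 2 +
      2 * (3 - sqrt3 ^+ 2) * c%:~R ^+ 2); first by ring.
  by rewrite sqr_sqrt2 sqr_sqrt3 !subrr; ring.
have [e3 /eqP] := sqrt3_irrational e2.
(* One of [b] and [c] vanishes; what remains is [a^2 = 6 c^2] or [a^2 = 2 b^2], and 2 divides both 6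
   and 2 exactly once. *)
rewrite -mulrA !mulf_eq0/= => /orP[/eqP b0|/eqP c0].
  have [//|//||a0 c0] := @sqr_eq_mul_sqr 2 6 a c.
    by move: e3; rewrite b0; lra.
  by rewrite a0 b0 c0.
have [//|//||a0 b0] := @sqr_eq_mul_sqr 2 2 a b.
  by move: e3; rewrite c0; lra.
by rewrite a0 b0 c0.
Qed.

Definition badly_approximable (alpha : R) := exists2 c : R, 0 < c &
  forall p q : int, p != 0 -> c <= `|p%:~R| * `|q%:~R + alpha * p%:~R|.

Lemma norm_intr_ge1 (p : int) : p != 0 -> 1 <= `|p%:~R : R|.
Proof. by move=> p0; rewrite -intr_norm ler1z -gtz0_ge1 normr_gt0. Qed.

(** Multiplication by the conjugate gives [b^2 - D a^2], a nonzero integer. When [u = |b + s a|] is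
    below 1, the conjugate is at most [u + 2 s |a| <= (1 + 2 s) |a|], whence the constant. *)
Lemma sqrt_badly_approximable (p D : nat) : prime p -> odd (logn p D) ->
  badly_approximable (Num.sqrt D%:R).
Proof.
move=> pp oD; pose s : R := Num.sqrt D%:R; rewrite -/s.
have s0 : 0 <= s by apply: sqrtr_ge0.
exists (1 + 2 * s)^-1 => [|a b a0]; first by rewrite invr_gt0; lra.
have norm1 : 1 <= `|b%:~R + s * a%:~R| * `|b%:~R - s * a%:~R|.
  have -> : `|b%:~R + s * a%:~R| * `|b%:~R - s * a%:~R| = `|(b ^+ 2 - D%:Z * a ^+ 2)%:~R|.
    have sD : s * s = D%:Z%:~R by rewrite -expr2 sqr_sqrtr ?ler0n.
    by rewrite -normrM intrB !intrM -sD; congr `|_|; ring.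
  apply: norm_intr_ge1; rewrite subr_eq0; apply: contra a0 => /eqP e.
  by have [_ ->] := sqr_eq_mul_sqr pp oD e.
have a1 := norm_intr_ge1 a0.
rewrite -div1r ler_pdivrMr; last lra.
pose u : R := `|b%:~R + s * a%:~R|; rewrite -/u in norm1 *.
have u0 : 0 <= u by apply: normr_ge0.
have [u1|u1] := leP 1 u.
  have au : 1 <= `|a%:~R| * u by nra.
  by apply: le_trans (au) _; apply: ler_peMr; lra.
have tri : `|b%:~R - s * a%:~R| <= u + 2 * s * `|a%:~R|.
  have -> : b%:~R - s * a%:~R = (b%:~R + s * a%:~R) - 2 * s * a%:~R by ring.
  apply: le_trans (ler_normB _ _) _; rewrite lerD2l normrM ger0_norm//; lra.
have h1 : u * `|b%:~R - s * a%:~R| <= u * (u + 2 * s * `|a%:~R|) by rewrite ler_wpM2l.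
have h2 : u * u <= u * `|a%:~R| by apply: ler_wpM2l => //; lra.
by lra.
Qed.

Lemma sqrt2_badly_approximable : badly_approximable sqrt2.
Proof. exact: (@sqrt_badly_approximable 2 2). Qed.

Lemma sqrt3_badly_approximable : badly_approximable sqrt3.
Proof. exact: (@sqrt_badly_approximable 3 3). Qed.

Lemma pigeonhole_mod1 (T : finType) (f : T -> R) (N : nat) : (0 < N)%N ->
  (N < #|T|)%N ->
  exists i j, i != j /\ exists k : int, `|f i - f j - k%:~R| < N%:R^-1.
Proof.
move=> N0 NT.
have Nr : 0 < N%:R :> R by rewrite ltr0n.
(* The circle is cut into [N] arcs of length [1 / N]: [fl i] modulo [N] is the arc containing [f i]
   modulo 1, and the quotient of [fl i] by [N] is the integer part of [f i]. *)
pose fl i : int := Num.floor (N%:R * f i).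
have modN i : (`|(fl i %% N%:Z)%Z|%N < N)%N.
  by rewrite -ltz_nat gez0_abs ?modz_ge0 ?ltz_pmod// -lt0n.
pose g i : 'I_N := Ordinal (modN i).
have : ~~ injectiveb g.
  by apply/injectiveP => /leq_card; rewrite card_ord leqNgt NT.
move=> /injectivePn[i [j ij gij]]; exists i, j; split=> //.
exists ((fl i %/ N%:Z)%Z - (fl j %/ N%:Z)%Z).
have e : (fl i %% N%:Z)%Z = (fl j %% N%:Z)%Z.
  have N0' : N%:Z != 0 by rewrite eqz_nat -lt0n.
  rewrite -[LHS]gez0_abs ?modz_ge0// -[RHS]gez0_abs ?modz_ge0//; congr Posz.
  exact: (congr1 (@nat_of_ord N) gij).
have fi := floor_itv (N%:R * f i); have fj := floor_itv (N%:R * f j).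
rewrite -/(fl i) (divz_eq (fl i) N%:Z) e in fi.
rewrite -/(fl j) (divz_eq (fl j) N%:Z) in fj.
move: fi fj; set A := (_ %/ _)%Z; set B := (_ %/ _)%Z; set C := (_ %% _)%Z.
rewrite intrB !(intrD, intrM) -[(Posz N)%:~R]/(N%:R).
move=> /andP[i1 i2] /andP[j1 j2].
rewrite -(ltr_pM2l Nr) divff ?gt_eqF// -[X in X * `|_|](gtr0_norm Nr) -normrM.
by rewrite ltr_norml; apply/andP; split; lra.
Qed.

(** Dirichlet's theorem, with the fraction reduced by its gcd, which cannot increase the error. Bad
    approximability then forbids a small denominator: [c <= Q |Q alpha - a| <= Q / N]. *)
Lemma badly_approximable_dirichlet (alpha c : R) :
  (forall p q : int, p != 0 -> c <= `|p%:~R| * `|q%:~R + alpha * p%:~R|) ->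
  forall N : nat, (0 < N)%N ->
  exists a Q : int, [/\ 0 < Q <= N%:Z, coprimez a Q,
    `|Q%:~R * alpha - a%:~R| < N%:R^-1 & c * N%:R <= Q%:~R].
Proof.
move=> bad N N0; have Nr : 0 < N%:R :> R by rewrite ltr0n.
have [|i [j [ij [k]]]] := @pigeonhole_mod1 'I_N.+1 (fun i => i%:R * alpha) N N0.
  by rewrite card_ord.
wlog lt_ji : i j ij k / (j < i)%N => [wl|].
  have [lt_ji|lt_ij|/val_inj eij] := ltngtP j i; last by rewrite eij eqxx in ij.
    exact: wl.
  move=> e; apply: (wl j i _ (- k)) => //; first by rewrite eq_sym.
  by rewrite rmorphN/= opprK -normrN; move: e; congr (`|_| < _); ring.
move=> close; pose Q0 : int := i%:Z - j%:Z.
have Q00 : 0 < Q0 by rewrite subr_gt0 ltz_nat.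
have Q0N : Q0 <= N%:Z.
  by rewrite lerBlDr -PoszD lez_nat (leq_trans (leq_ord i))// leq_addr.
have {}close : `|Q0%:~R * alpha - k%:~R| < N%:R^-1.
  by move: close; rewrite -mulrBl intrB.
have [g gE] : exists g, g = gcdz k Q0 by eexists.
have g0 : 0 < g by rewrite gE lt_def gcdz_eq0 negb_and (gt_eqF Q00) orbT.
have [a ka] : exists a, k = a * g by apply/dvdzP; rewrite gE dvdz_gcdl.
have [Q Qe] : exists Q, Q0 = Q * g by apply/dvdzP; rewrite gE dvdz_gcdr.
have Qpos : 0 < Q by move: Q00; rewrite Qe pmulr_lgt0.
have cop : coprimez a Q.
  move: gE; rewrite ka Qe -mulz_gcdl gtz0_abs// => e.
  by apply/eqP; apply: (mulIf (negbT (gt_eqF g0))); rewrite mul1r -e.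
have g1 : 1 <= g by [].
have {close} lt1 : `|Q%:~R * alpha - a%:~R| < N%:R^-1.
  apply: le_lt_trans close; rewrite ka Qe !intrM.
  have -> : Q%:~R * g%:~R * alpha - a%:~R * g%:~R = (Q%:~R * alpha - a%:~R) * g%:~R by ring.
  rewrite normrM ler_peMr// ger0_norm ?ler0z ?(ltW g0)//.
  by rewrite ler1z.
exists a, Q; split => //.
  rewrite Qpos/=; apply: le_trans Q0N; rewrite Qe ler_peMr//; exact: ltW.
have Qn0 : Q != 0 by rewrite gt_eqF.
have := bad Q (- a) Qn0; rewrite rmorphN/= addrC [alpha * _]mulrC.
rewrite (gtr0_norm (_ : 0 < Q%:~R)) ?ltr0z// => h.
rewrite -ler_pdivlMr//; apply: le_trans h _; rewrite ler_pM2l ?ltr0z//.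
exact: ltW.
Qed.

(* If [a / Q] approximates [alpha] to within [1 / Q^2], then the points
   [alpha * j], for [j] in [Q] consecutive integers, are within [1 / Q] of the
   regular polygon formed by the multiples of [1 / Q] on the circle. *)
Lemma badly_approximable_dense (alpha : R) : badly_approximable alpha ->
  exists2 K : R, 0 < K & forall (T x0 t : R) (u0 : int), 1 <= T ->
  exists j k : int, (u0%:~R : R) <= j%:~R <= u0%:~R + T /\
    t < x0 + k%:~R + alpha * j%:~R < t + K / T.
Proof.
move=> [c c0 bad]; exists (6 / c) => [|T x0 t u0 T1]; first by rewrite divr_gt0.
have T0 : 0 <= T by lra.
pose N := Num.truncn T; have /andP[NT TN] := truncn_itv T0.
rewrite -/N in NT TN.
have N0 : (0 < N)%N by rewrite -ltnS -(ltr_nat R); apply: le_lt_trans TN.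
have [a [Q [/andP[Q0 QN] cop close cNQ]]] := badly_approximable_dirichlet bad N0.
have Q0r : 0 < Q%:~R :> R by rewrite ltr0z.
have QNr : Q%:~R <= N%:R :> R by have : Q%:~R <= (N%:Z)%:~R :> R by rewrite ler_int.
pose X := x0 + alpha * u0%:~R.
(* [M / Q] exceeds [t - X] by more than [1 / Q] and at most [2 / Q]. An error below [1 / Q] then
   leaves the point between [t] and [t + 3 / Q], and [3 / Q <= 3 / (c N) <= 6 / (c T)]. *)
pose M := Num.floor (Q%:~R * (t - X)) + 2.
have [[u v] /= uv] := coprimezP _ _ cop.
(* By Bezout [u] inverts [a] modulo [Q], so [a * i] is congruent to [M]. *)
pose i := (M * u %% Q)%Z.
have i0 : 0 <= i by rewrite modz_ge0// gt_eqF.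
have iQ : i < Q by rewrite ltz_pmod.
have [k ek] : exists k, M = a * i + Q * k.
  have := divz_eq (M * u) Q; rewrite -/i; set w := (_ %/ _)%Z => e.
  exists (M * v + a * w).
  have -> : i = M * u - w * Q by rewrite e addrAC subrr add0r.
  by rewrite -{1}[M]mulr1 -uv; ring.
exists (u0 + i), k.
have i0r : 0 <= i%:~R :> R by rewrite ler0z.
have iQr : i%:~R <= Q%:~R :> R by rewrite ler_int ltW.
rewrite intrD; split; first by apply/andP; split; lra.
have /andP[fl1 fl2] := floor_itv (Q%:~R * (t - X)).
have eM : M%:~R = a%:~R * i%:~R + Q%:~R * k%:~R :> R by rewrite ek intrD !intrM.
move: fl2; rewrite intrD => fl2.
have M1 : Q%:~R * (t - X) + 1 < M%:~R by rewrite intrD; lra.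
have M2 : M%:~R <= Q%:~R * (t - X) + 2 by rewrite intrD; lra.
pose E := Q%:~R * alpha - a%:~R.
have E1 : `|E * i%:~R| < 1.
  rewrite normrM (ger0_norm i0r).
  apply: (@le_lt_trans _ _ (`|E| * N%:R)); first by rewrite ler_wpM2l//; lra.
  by rewrite -ltr_pdivlMr ?ltr0n// div1r.
have QT : 3 / Q%:~R <= 6 / c / T.
  have NT2 : T <= 2 * N%:R.
    have N1 : 1 <= N%:R :> R by rewrite ler1n.
    by move: TN; rewrite -addn1 natrD; lra.
  have cT : c * T <= c * (2 * N%:R) by rewrite ler_pM2l.
  have cT0 : 0 < c * T by apply: mulr_gt0; lra.
  have -> : 6 / c / T = 6 / (c * T) by field; apply/andP; split; rewrite gt_eqF//; lra.
  by rewrite ler_pdivrMr// mulrAC ler_pdivlMr//; lra.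
have val : Q%:~R * (x0 + k%:~R + alpha * (u0%:~R + i%:~R) - t) =
    M%:~R - Q%:~R * (t - X) + E * i%:~R.
  by rewrite eM /X /E; ring.
move: E1; rewrite ltr_norml => /andP[E1 E2].
set Y := x0 + _ + _ in val *.
apply/andP; split.
  by rewrite -subr_gt0 -(pmulr_rgt0 _ Q0r) val; lra.
apply: (@lt_le_trans _ _ (t + 3 / Q%:~R)); last by rewrite lerD2l.
by rewrite -ltrBlDl ltr_pdivlMr// mulrC val; lra.
Qed.

(* The points [k - alpha j] with [|j| <= B] are separated by [c / (2 B)], so
   one of the two half-intervals of that length around [x] avoids them. *)
Lemma floor_pattern_interval (alpha c : R) : 0 < c -> c <= 1 ->
  (forall p q : int, p != 0 -> c <= `|p%:~R| * `|q%:~R + alpha * p%:~R|) ->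
  forall B x : R, 1 <= B -> exists t : R, forall x', t < x' < t + c / (4 * B) ->
  forall j k : int, `|j%:~R| <= B ->
    (0 <= x + (k%:~R + alpha * j%:~R)) = (0 <= x' + (k%:~R + alpha * j%:~R)).
Proof.
move=> c0 c1 bad B x B1.
pose e := c / (4 * B); have B0 : 0 < 4 * B by lra.
have e0 : 0 < e by rewrite divr_gt0.
have sep (j k j' k' : int) : `|j%:~R| <= B -> `|j'%:~R| <= B ->
    `|(k%:~R + alpha * j%:~R) - (k'%:~R + alpha * j'%:~R)| < 2 * e ->
    k%:~R + alpha * j%:~R = k'%:~R + alpha * j'%:~R.
  move=> jB j'B.
  have -> : (k%:~R + alpha * j%:~R) - (k'%:~R + alpha * j'%:~R) =
    (k - k')%:~R + alpha * (j - j')%:~R by rewrite !intrB; ring.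
  have eB : 2 * e * (2 * B) = c by rewrite /e; field; lra.
  have [/eqP|jj'] := eqVneq (j - j') 0.
    rewrite subr_eq0 => /eqP ->; rewrite subrr mulr0 addr0.
    have [/eqP|kk' lt] := eqVneq (k - k') 0; first by rewrite subr_eq0 => /eqP ->.
    by have := norm_intr_ge1 kk'; nra.
  move=> lt; have := bad _ (k - k') jj'.
  have : `|(j - j')%:~R| <= 2 * B :> R.
    by rewrite intrB; apply: le_trans (ler_normB _ _) _; lra.
  have := normr_ge0 ((k - k')%:~R + alpha * (j - j')%:~R).
  have := normr_ge0 ((j - j')%:~R : R).
  by nra.
(* A point in [[0, e)] excludes, by the separation [2 e], any other in [(- e, 0)], so [x] may move
   right by less than [e]. Without such a point it may move left. *)
have [[j0 [k0 [j0B low up]]]|no] := pselect (exists j k : int,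
    [/\ `|j%:~R| <= B, 0 <= x + (k%:~R + alpha * j%:~R) &
    x + (k%:~R + alpha * j%:~R) < e]).
  exists x => x' /andP[xx' x'x] j k jB.
  apply/idP/idP => [|h]; first by lra.
  rewrite leNgt; apply/negP => neg.
  suff : k%:~R + alpha * j%:~R = k0%:~R + alpha * j0%:~R by lra.
  by apply: sep => //; rewrite ltr_norml; apply/andP; split; rewrite /e in up *; lra.
exists (x - e) => x' /andP[xx' x'x] j k jB.
apply/idP/idP => [h|]; last by rewrite /e in x'x; lra.
rewrite leNgt; apply/negP => neg.
by apply: no; exists j, k; split => //; lra.
Qed.

(** The pattern up to [B] is constant on an interval of length of order [1 / B], and any range of
    [j] of length of order [B] brings the orbit into it. *)
Lemma badly_approximable_return (alpha : R) : badly_approximable alpha ->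
  exists2 K : R, 0 < K & forall B x u0 : R, 1 <= B ->
  exists j0 k0 : int, u0 <= j0%:~R <= u0 + K * B /\
  forall j k : int, `|j%:~R| <= B ->
    (0 <= x + (k%:~R + alpha * j%:~R) < 1) =
    (0 <= x + (k0%:~R + alpha * j0%:~R) + (k%:~R + alpha * j%:~R) < 1).
Proof.
move=> bad; have [K0 K00 dense] := badly_approximable_dense bad.
have [c' c'0 bad'] := bad; pose c := Num.min c' 1.
have c0 : 0 < c by rewrite lt_min c'0 ltr01.
have c1 : c <= 1 by rewrite ge_min lexx orbT.
have badc p q : p != 0 -> c <= `|p%:~R| * `|q%:~R + alpha * p%:~R|.
  by move=> /bad' h; apply: le_trans (h q); rewrite ge_min lexx.
have K4 : 0 < 4 * K0 / c by rewrite divr_gt0// mulr_gt0.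
(* The 2 pays for rounding [u0] up and for the 1 in [T]; [T] is large enough that
   [K0 / T <= c / (4 * B)]. *)
exists (4 * K0 / c + 2) => [|B x u0 B1]; first by lra.
have [t pat] := floor_pattern_interval c0 c1 badc x B1.
pose T := 4 * K0 / c * B + 1.
have T1 : 1 <= T by rewrite /T; nra.
have [j0 [k0 [/andP[j0u uj0] /andP[tx xt]]]] := dense T x t (Num.ceil u0) T1.
have /andP[cu uc] := ceil_itv u0.
exists j0, k0; split.
  move: cu; rewrite intrB => cu.
  by apply/andP; split; rewrite /T in uj0; lra.
have tK : K0 / T <= c / (4 * B).
  rewrite ler_pdivrMr; last lra.
  rewrite mulrAC ler_pdivlMr; last lra.
  have -> : c * T = 4 * K0 * B + c by rewrite /T; field; lra.
  by lra.
have x't : t < x + (k0%:~R + alpha * j0%:~R) < t + c / (4 * B).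
  by apply/andP; split; lra.
move=> j k jB; rewrite (pat _ x't)//; congr (_ && _).
(* The condition below 1 is the negation of the sign condition for [k - 1]. *)
have := pat _ x't j (k - 1) jB; rewrite intrB => h.
rewrite !ltNge; congr (~~ _); rewrite -[LHS]subr_ge0 -[RHS]subr_ge0.
by move: h; congr (_ = _); congr (_ <= _); ring.
Qed.

Lemma badly_approximable_dense1 (alpha : R) :
  badly_approximable alpha -> forall x0 t e : R, 0 < e ->
  exists j k : int, t < x0 + k%:~R + alpha * j%:~R < t + e.
Proof.
move=> /badly_approximable_dense[K K0 H] x0 t e e0.
have Ke : 0 < K / e by rewrite divr_gt0.
have [|j [k [_ /andP[h1 h2]]]] := H (K / e + 1) x0 t 0; first by lra.
exists j, k; rewrite h1/=; apply: lt_trans h2 _; rewrite ltrD2l ltr_pdivrMr; last lra.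
by rewrite mulrDr mulr1 [e * _]mulrC divfK ?gt_eqF//; lra.
Qed.

(** There are [(N + 1)^2] values for [N^2] arcs: two free integers gain the exponent 2, where a
    single badly approximable number allows only 1. Independence of 1, sqrt2 and sqrt6 makes the
    relation nonzero, and a change of sign makes it positive. *)
Lemma small_relation (N : nat) : (0 < N)%N -> exists a b c : int,
  [/\ `|b%:~R| <= N%:R :> R, `|c%:~R| <= N%:R :> R &
   0 < a%:~R + sqrt2 * b%:~R + sqrt2 * sqrt3 * c%:~R < (N%:R ^+ 2)^-1].
Proof.
move=> N0.
pose f (ij : 'I_N.+1 * 'I_N.+1) : R := sqrt2 * ij.1%:R + sqrt2 * sqrt3 * ij.2%:R.
have [||[i1 j1] [[i2 j2] [ne [k]]]] := @pigeonhole_mod1 _ f (N ^ 2)%N.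
- by rewrite expn_gt0 N0.
- by rewrite card_prod card_ord mulnn ltn_sqr.
rewrite natrX /f/=.
set b : int := i1%:Z - i2%:Z; set c : int := j1%:Z - j2%:Z.
have -> : sqrt2 * i1%:R + sqrt2 * sqrt3 * j1%:R - (sqrt2 * i2%:R + sqrt2 * sqrt3 * j2%:R)
    - k%:~R = (- k)%:~R + sqrt2 * b%:~R + sqrt2 * sqrt3 * c%:~R.
  by rewrite !intrB rmorphN/=; ring.
have bnd (i j : 'I_N.+1) : `|(i%:Z - j%:Z)%:~R| <= N%:R :> R.
  have iN : i%:R <= N%:R :> R by rewrite ler_nat leq_ord.
  have jN : j%:R <= N%:R :> R by rewrite ler_nat leq_ord.
  have i0 : 0 <= i%:R :> R by apply: ler0n.
  have j0 : 0 <= j%:R :> R by apply: ler0n.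
  by rewrite intrB ler_norml -!pmulrn; apply/andP; split; lra.
set s := _ + _ => s1.
have s0 : s != 0.
  apply/eqP => /sqrt26_independent[_ /eqP b0 /eqP c0].
  move: ne; rewrite /b /c !subr_eq0 in b0 c0.
  move: b0 c0 => /eqP[/val_inj ->] /eqP[/val_inj ->]; by rewrite eqxx.
have [sp|sn|/eqP] := ltrgtP 0 s; last by rewrite eq_sym (negPf s0).
  exists (- k), b, c; split; [exact: bnd|exact: bnd|].
  by rewrite -/s sp; move: s1; rewrite gtr0_norm.
exists k, (- b), (- c); split; try by rewrite rmorphN normrN; exact: bnd.
have -> : k%:~R + sqrt2 * (- b)%:~R + sqrt2 * sqrt3 * (- c)%:~R = - s.
  by rewrite /s !rmorphN/=; ring.
by rewrite oppr_gt0 sn; move: s1; rewrite ltr0_norm.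
Qed.

End Approximation.

(** * An example of dimension 4 *)

Section MoreGeneral.
Context {R : realType} {d m : nat} (D : cut_and_project_data R d m).

(** Both projections fix E, so they differ by pi of the vertical part; on a bounded strip they are a
    bounded distance apart. *)
Lemma proj_pi_rho_dist : exists2 K : R, 0 < K &
  forall v, `|proj_pi D v - proj_rho D v| <= K * `|height D v|.
Proof.
have [K K0 le] := linear_norm_le (proj_pi D).
exists K => // v; rewrite proj_rhoE {1}(graph_vertical D v) linearD/=.
have -> : proj_pi D (graph_map (slope_map D) (lsubmx v)) = graph_map (slope_map D) (lsubmx v).
  exact: (daddv_pi_id (internal_direct D) (graph_map_phys D _)).
rewrite addrAC subrr add0r; apply: le_trans (le _) _; rewrite ler_wpM2l ?(ltW K0)//.
apply: norm_le_coord => // i; rewrite /vertical_map; case: (split_ordP i) => j ->.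
  by rewrite row_mxEl mxE normr0.
by rewrite row_mxEr coord_norm_le.
Qed.

(** The strip lies between the open set [f > 0] and the closed set [f >= 0], so its boundary is
    contained in [f = 0]. *)
Lemma regular_window_pos W (f : 'rV[R]_(d + m) -> R) : continuous f ->
  (forall v, strip D W v -> 0 <= f v) -> (forall v, 0 < f v -> strip D W v) ->
  (forall v, shifted_lattice D v -> f v != 0) -> regular_window D W.
Proof.
move=> cf sf fs ne; apply/seteqP; split => // z [sz [cl]]; apply.
have : 0 <= f z.
  rewrite leNgt; apply/negP => fz.
  have : nbhs z [set v | f v < 0].
    exact: (cf z _ (lt_nbhsl fz)).
  by move=> /cl[v [/sf]] /=; rewrite leNgt => /negP.
rewrite le_eqVlt eq_sym (negPf (ne _ sz))/= => fz.
suff : nbhs z [set v | 0 < f v] by apply: filterS; exact: fs.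
exact: (cf z _ (lt_nbhsr fz)).
Qed.

End MoreGeneral.

(** * The data of the example and its two windows *)

Section Example.
Context {R : realType}.
Implicit Types (p q : R).

Notation a := (Num.sqrt (2%:R : R)).
Notation b := (Num.sqrt (3%:R : R)).

Lemma sqrt2_ge1 : 1 <= a.
Proof. have := @sqr_sqrt2 R; have := @sqrt2_gt0 R; nra. Qed.
Lemma sqrt2_le2 : a <= 2.
Proof. have := @sqr_sqrt2 R; have := @sqrt2_gt0 R; nra. Qed.
Lemma sqrt3_ge1 : 1 <= b.
Proof. have := @sqr_sqrt3 R; have := @sqrt3_gt0 R; nra. Qed.
Lemma sqrt3_le2 : b <= 2.
Proof. have := @sqr_sqrt3 R; have := @sqrt3_gt0 R; nra. Qed.

Lemma sqrt2_norm_le (u c : R) : `|u| <= c -> `|a * u| <= 2 * c.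
Proof.
move=> uc; rewrite normrM ger0_norm ?sqrtr_ge0//.
by apply: ler_pM => //; exact: sqrt2_le2.
Qed.

Lemma sqrt3_norm_le (u c : R) : `|u| <= c -> `|b * u| <= 2 * c.
Proof.
move=> uc; rewrite normrM ger0_norm ?sqrtr_ge0//.
by apply: ler_pM => //; exact: sqrt3_le2.
Qed.

Definition row4 p1 p2 q1 q2 : 'rV[R]_(2 + 2) :=
  row_mx (\row_j [:: p1; p2]`_j) (\row_j [:: q1; q2]`_j).

Lemma forall_row4 (P : R -> Prop) p1 p2 q1 q2 :
  (forall i, P (row4 p1 p2 q1 q2 0 i)) <-> [/\ P p1, P p2, P q1 & P q2].
Proof.
rewrite /row4; split=> [H|[? ? ? ?] i].
  split.
  - by have := H (lshift 2 0); rewrite row_mxEl mxE.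
  - by have := H (lshift 2 1); rewrite row_mxEl mxE.
  - by have := H (rshift 2 0); rewrite row_mxEr mxE.
  - by have := H (rshift 2 1); rewrite row_mxEr mxE.
by case: (split_ordP i) => -[[|[|//]] ?] ->; rewrite ?row_mxEl ?row_mxEr mxE.
Qed.

Lemma row4_surj (v : 'rV[R]_(2 + 2)) :
  v = row4 (lsubmx v 0 0) (lsubmx v 0 1) (rsubmx v 0 0) (rsubmx v 0 1).
Proof.
rewrite -{1}[v]hsubmxK /row4; congr row_mx; apply/rowP => -[[|[|//]] ?];
  by rewrite [RHS]mxE/=; congr (_ _ _); apply: val_inj.
Qed.

Lemma row4D p1 p2 q1 q2 p1' p2' q1' q2' :
  row4 p1 p2 q1 q2 + row4 p1' p2' q1' q2' =
  row4 (p1 + p1') (p2 + p2') (q1 + q1') (q2 + q2').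
Proof.
rewrite /row4 add_row_mx; congr row_mx; apply/rowP => -[[|[|//]] ?]; by rewrite !mxE.
Qed.

Lemma row4N p1 p2 q1 q2 : - row4 p1 p2 q1 q2 = row4 (- p1) (- p2) (- q1) (- q2).
Proof.
rewrite /row4 opp_row_mx; congr row_mx; apply/rowP => -[[|[|//]] ?]; by rewrite !mxE.
Qed.

(** The matrix acts on row vectors from the right; the signs make the height of [(p, q)] equal to
    [(q1 + sqrt2 p1, q2 + p1 + sqrt3 p2)]. *)
Definition slope : 'Hom('rV[R]_2, 'rV[R]_2) := linfun (mulmxr
  (\matrix_(i < 2, j < 2) (nth [::] [:: [:: - a; - 1]; [:: 0; - b]] i)`_j)).

Lemma slopeE (x : 'rV[R]_2) :
  slope x = \row_j [:: - (a * x 0 0); - (x 0 0 + b * x 0 1)]`_j.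
Proof.
rewrite /slope lfunE/=; apply/rowP => j; rewrite !mxE big_ord_recl big_ord1 !mxE/=.
by case: j => [[|[|//]] ?] /=; rewrite [lift _ _](_ : _ = 1) //; try (by apply: val_inj); ring.
Qed.

(** Spanned by [(sqrt2, 0, 1, 0)] and [(0, sqrt3, 0, 1)]. Irrationality keeps nonzero lattice
    vectors out of it, which makes pi injective on the lattice; the vertical space contains lattice
    vectors. *)
Definition internal : {vspace 'rV[R]_(2 + 2)} := limg (linfun (mulmxr
  (row_mx (\matrix_(i < 2, j < 2) (nth [::] [:: [:: a; 0]; [:: 0; b]] i)`_j) 1%:M))).

Lemma internalP v : reflect (exists q1 q2, v = row4 (a * q1) (b * q2) q1 q2)
  (v \in internal).
Proof.
have E t : linfun (mulmxr
  (row_mx (\matrix_(i < 2, j < 2) (nth [::] [:: [:: a; 0]; [:: 0; b]] i)`_j) 1%:M)) t =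
  row4 (a * t 0 0) (b * t 0 1) (t 0 0) (t 0 1) :> 'rV[R]_(2 + 2).
  rewrite lfunE/= mul_mx_row mulmx1 /row4; congr row_mx; apply/rowP => j; rewrite !mxE.
    rewrite big_ord_recl big_ord1 !mxE/=.
    by case: j => [[|[|//]] ?] /=; rewrite [lift _ _](_ : _ = 1) //; try (by apply: val_inj); ring.
  by case: j => [[|[|//]] ?] /=; congr (_ _ _); apply: val_inj.
apply: (iffP memv_imgP) => [[t _ ->]|[q1 [q2 ->]]].
  by rewrite E; do 2 eexists.
exists (\row_j [:: q1; q2]`_j); first by rewrite memvf.
by rewrite E !mxE.
Qed.

Lemma graph_row4 (x : 'rV[R]_2) : graph_map slope x =
  row4 (x 0 0) (x 0 1) (- (a * x 0 0)) (- (x 0 0 + b * x 0 1)).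
Proof.
rewrite /graph_map slopeE /row4; congr row_mx.
by apply/rowP => -[[|[|//]] ?]; rewrite mxE/=; congr (_ _ _); apply: val_inj.
Qed.

Lemma row4_inj p1 p2 q1 q2 p1' p2' q1' q2' :
  row4 p1 p2 q1 q2 = row4 p1' p2' q1' q2' ->
  [/\ p1 = p1', p2 = p2', q1 = q1' & q2 = q2'].
Proof.
move=> /eq_row_mx[/rowP e /rowP f].
by split; [have := e 0|have := e 1|have := f 0|have := f 1]; rewrite !mxE.
Qed.

Lemma row4_phys x1 x2 :
  row4 x1 x2 (- (a * x1)) (- (x1 + b * x2)) \in physical_space slope.
Proof.
apply/physical_spaceP; exists (\row_j [:: x1; x2]`_j).
by rewrite graph_row4 !mxE.
Qed.

Lemma example_span : (physical_space slope + internal = fullv)%VS.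
Proof.
apply/eqP; rewrite eqEsubv subvf /=; apply/subvP => v _.
rewrite [v]row4_surj; set p1 := lsubmx v 0 0; set p2 := lsubmx v 0 1.
set q1 := rsubmx v 0 0; set q2 := rsubmx v 0 1.
have a2 := @sqr_sqrt2 R; have b2 := @sqr_sqrt3 R.
(* The divisors are [1 + a^2] and [1 + b^2]. *)
pose x1 := (p1 - a * q1) / 3; pose x2 := (p2 - b * q2 - b * x1) / 4.
pose t1 := q1 + a * x1; pose t2 := q2 + (x1 + b * x2).
apply/memv_addP; exists (row4 x1 x2 (- (a * x1)) (- (x1 + b * x2))).
  exact: row4_phys.
exists (row4 (a * t1) (b * t2) t1 t2); first by apply/internalP; do 2 eexists.
have e1 : x1 + a * t1 = p1.
  transitivity (a * q1 + (1 + a ^+ 2) * x1); first by rewrite /t1; ring.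
  by rewrite a2 /x1; field.
have e2 : x2 + b * t2 = p2.
  transitivity (b * q2 + b * x1 + (1 + b ^+ 2) * x2); first by rewrite /t2; ring.
  by rewrite b2 /x2; field.
rewrite row4D e1 e2; congr row4; rewrite /t1 /t2; ring.
Qed.

Lemma example_direct : (physical_space slope :&: internal = 0)%VS.
Proof.
apply/eqP; rewrite -subv0; apply/subvP => v; rewrite memv_cap memv0.
move=> /andP[/physical_spaceP[x ->] /internalP[q1 [q2]]].
rewrite graph_row4 => /row4_inj[e1 e2 e3 e4].
have a2 := @sqr_sqrt2 R; have b2 := @sqr_sqrt3 R.
have x10 : x 0 0 = 0.
  have := congr1 (fun t => a * t) e3; have /= := congr1 (fun t => t * x 0 0) a2.
  by lra.
have x20 : x 0 1 = 0.
  rewrite x10 add0r in e4.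
  have := congr1 (fun t => b * t) e4; have /= := congr1 (fun t => t * x 0 1) b2.
  by lra.
rewrite x10 x20; apply/eqP/rowP => i; rewrite [RHS]mxE; move: i.
by apply/(forall_row4 (fun t => t = 0)); split; ring.
Qed.

Lemma int_row4P v : int_lattice R (2 + 2) v <->
  exists p1 p2 q1 q2 : int, v = row4 p1%:~R p2%:~R q1%:~R q2%:~R.
Proof.
split=> [|[p1 [p2 [q1 [q2 ->]]]]]; last first.
  by apply/(forall_row4 (fun x => x \is a Num.int)); split; apply: intr_int.
rewrite [v]row4_surj => /(forall_row4 (fun x => x \is a Num.int)).
by move=> [/intrP[? ->] /intrP[? ->] /intrP[? ->] /intrP[? ->]]; do 4 eexists.
Qed.

Lemma example_inj : {in int_lattice R (2 + 2) &,
  injective (daddv_pi (physical_space slope) internal)}.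
Proof.
move=> v w; rewrite !inE => vZ wZ e; apply/eqP; rewrite -subr_eq0; apply/eqP.
have : v - w \in internal.
  have := daddv_pi_add (w := v - w) example_direct.
  rewrite example_span memvf => /(_ isT) <-.
  by rewrite linearB/= e subrr add0r memv_pi.
have /int_row4P[p1 [p2 [q1 [q2 ->]]]] : int_lattice R (2 + 2) (v - w).
  by move=> i; rewrite mxE [(- w) _ _]mxE rpredB ?vZ ?wZ.
move=> /internalP[t1 [t2 /row4_inj[e1 e2 e3 e4]]].
have [|-> q10] := @sqrt2_irrational R p1 (- q1); first by rewrite rmorphN/= e1 e3; ring.
have [|-> q20] := @sqrt3_irrational R p2 (- q2); first by rewrite rmorphN/= e2 e4; ring.
have -> : q1 = 0 by lra.
have -> : q2 = 0 by lra.
apply/rowP => i; rewrite [RHS]mxE; move: i.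
by apply/(forall_row4 (fun t => t = 0)).
Qed.

(** The halves keep the shifted lattice off the sides of both windows: a point on a side would give
    an integer relation with an odd coefficient. *)
Definition example : cut_and_project_data R 2 2 :=
  @CutAndProjectData R 2 2 slope internal (torus_proj (row4 0 0 (1 / 2) (1 / 2)))
    isT isT example_span example_direct example_inj.

Lemma height_row4 p1 p2 q1 q2 :
  height example (row4 p1 p2 q1 q2) = \row_j [:: q1 + a * p1; q2 + p1 + b * p2]`_j.
Proof.
rewrite /height /= /row4 row_mxKl row_mxKr slopeE.
by apply/rowP => -[[|[|//]] ?]; rewrite !mxE/=; ring.
Qed.

Lemma shifted_row4P v : shifted_lattice example v <->
  exists p1 p2 q1 q2 : int, v = row4 p1%:~R p2%:~R (q1%:~R + 1 / 2) (q2%:~R + 1 / 2).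
Proof.
have s0 : shifted_lattice example (row4 0 0 (1 / 2) (1 / 2)) by [].
have -> : v = row4 0 0 (1 / 2) (1 / 2) + (v - row4 0 0 (1 / 2) (1 / 2)).
  by rewrite addrC subrK.
rewrite (shifted_latticeD _ s0) int_row4P; split=> -[p1 [p2 [q1 [q2 e]]]];
  exists p1, p2, q1, q2.
  by rewrite e row4D !add0r ![1 / 2 + _]addrC.
by rewrite addrC in e; rewrite (canRL (addrK _) e) row4N row4D !oppr0 !addr0 !addrK.
Qed.

Lemma strip_cubical_row4 p1 p2 q1 q2 :
  strip example (cubical_window R 2 2) (row4 p1 p2 q1 q2) <->
  0 <= q1 + a * p1 < 1 /\ 0 <= q2 + p1 + b * p2 < 1.
Proof.
rewrite strip_cubicalP height_row4; split=> [H|[? ?] -[[|[|//]] ?]]; rewrite ?mxE//.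
by have := H 0; have := H 1; rewrite !mxE.
Qed.

(** The window is the Minkowski sum of the unit square and the segments from 0 to [(a, 1)] and
    [(0, b)], the heights of the first two basis vectors: a hexagon given by three pairs of
    inequalities. *)
Lemma strip_canonical_row4 p1 p2 q1 q2 (x1 := q1 + a * p1) (x2 := q2 + p1 + b * p2) :
  strip example (canonical_window example) (row4 p1 p2 q1 q2) <->
  [/\ 0 <= x1 <= 1 + a, 0 <= x2 <= 2 + b & - (a * (1 + b)) <= x1 - a * x2 <= 1].
Proof.
have a1 := sqrt2_ge1; have b1 := sqrt3_ge1.
have a0 := @sqrt2_gt0 R; have b0 := @sqrt3_gt0 R.
rewrite strip_canonicalP; split.
  move=> [u]; rewrite [u]row4_surj => /(forall_row4 (fun t => 0 <= t <= 1)).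
  set P1 := lsubmx u 0 0; set P2 := lsubmx u 0 1.
  set Q1 := rsubmx u 0 0; set Q2 := rsubmx u 0 1.
  move=> [/andP[h1 h2] /andP[h3 h4] /andP[h5 h6] /andP[h7 h8]].
  rewrite !height_row4 => /rowP e; have := e 0; have := e 1; rewrite !mxE/=.
  rewrite -/x1 -/x2 => -> ->.
  have g1 : 0 <= a * P1 <= a by apply/andP; split; nra.
  have g2 : 0 <= b * P2 <= b by apply/andP; split; nra.
  have g3 : 0 <= a * (b * P2) <= a * b by apply/andP; split; nra.
  have g4 : 0 <= a * Q2 <= a by apply/andP; split; nra.
  move: g1 g2 g3 g4 => /andP[? ?] /andP[? ?] /andP[? ?] /andP[? ?].
  by split; apply/andP; split; lra.
move=> [/andP[h1 h2] /andP[h3 h4] /andP[h5 h6]].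
(* [t] will be the coordinate [p1] of a preimage. Its constraints describe an interval, and the
   largest of the lower bounds is chosen. *)
have [t [t01 tx2 tx1]] : exists t, [/\ 0 <= t <= 1, t <= x2 <= t + 1 + b & 0 <= x1 - a * t <= 1].
  pose t := Num.max (Num.max 0 (x2 - 1 - b)) ((x1 - 1) / a).
  have u1 : (x1 - 1) / a <= 1 by rewrite ler_pdivrMr//; lra.
  have u2 : (x1 - 1) / a <= x2 by rewrite ler_pdivrMr//; lra.
  have t0 : 0 <= t by rewrite !le_max lexx.
  have t1 : t <= 1 by rewrite !ge_max u1 ler01 andbT /=; lra.
  have t2 : t <= x2 by rewrite !ge_max u2 h3 andbT /=; lra.
  have t3 : x2 - 1 - b <= t by rewrite !le_max lexx orbT.
  have t4 : (x1 - 1) / a <= t by rewrite !le_max lexx !orbT.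
  have t5 : t <= x1 / a.
    rewrite !ge_max ler_pM2r ?invr_gt0// divr_ge0 ?(ltW a0)//=.
    by rewrite ler_pdivlMr//; apply/andP; split; lra.
  exists t; split; apply/andP; split => //; try lra.
    by move: t5; rewrite ler_pdivlMr//; lra.
  by move: t4; rewrite ler_pdivrMr//; lra.
move: t01 tx2 tx1 => /andP[? ?] /andP[? ?] /andP[? ?].
(* The rest of [x2], between 0 and [1 + b], is shared by setting [p2 = q2 = s]. *)
pose s := (x2 - t) / (1 + b).
have s0 : 0 <= s by rewrite divr_ge0//; lra.
have s1 : s <= 1 by rewrite ler_pdivrMr; lra.
exists (row4 t s (x1 - a * t) s).
  by apply/(forall_row4 (fun t => 0 <= t <= 1)); split; apply/andP.
rewrite !height_row4; apply/rowP => -[[|[|//]] ?]; rewrite !mxE/= -?/x1 -?/x2.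
  by ring.
rewrite /s; field; lra.
Qed.

End Example.

(** * Regularity and total irrationality of the example *)

Section ExampleProperties.
Context {R : realType}.

Notation a := (Num.sqrt (2%:R : R)).
Notation b := (Num.sqrt (3%:R : R)).
Notation D := (@example R).
Notation cubical := (cubical_window R 2 2).
Notation canonical := (canonical_window D).

Definition ht1 (v : 'rV[R]_(2 + 2)) := v 0 (rshift 2 0) + a * v 0 (lshift 2 0).
Definition ht2 (v : 'rV[R]_(2 + 2)) :=
  v 0 (rshift 2 1) + v 0 (lshift 2 0) + b * v 0 (lshift 2 1).

Lemma ht1_row4 (p1 p2 q1 q2 : R) : ht1 (row4 p1 p2 q1 q2) = q1 + a * p1.
Proof. by rewrite /ht1 /row4 !row_mxEl !row_mxEr !mxE. Qed.

Lemma ht2_row4 (p1 p2 q1 q2 : R) : ht2 (row4 p1 p2 q1 q2) = q2 + p1 + b * p2.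
Proof. by rewrite /ht2 /row4 !row_mxEl !row_mxEr !mxE. Qed.

Lemma ht1D u v : ht1 (u + v) = ht1 u + ht1 v.
Proof. by rewrite /ht1 !mxE; ring. Qed.

Lemma ht2D u v : ht2 (u + v) = ht2 u + ht2 v.
Proof. by rewrite /ht2 !mxE; ring. Qed.

Lemma ht1_continuous : continuous ht1.
Proof.
move=> v; have c i := @coord_continuous R 1 (2 + 2) 0 i v.
exact: (cvgD (c _) (cvgM (cvg_cst a) (c _))).
Qed.

Lemma ht2_continuous : continuous ht2.
Proof.
move=> v; have c i := @coord_continuous R 1 (2 + 2) 0 i v.
exact: (cvgD (cvgD (c _) (c _)) (cvgM (cvg_cst b) (c _))).
Qed.

Lemma strip_cubicalE v : strip D cubical v <-> 0 <= ht1 v < 1 /\ 0 <= ht2 v < 1.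
Proof. by rewrite [v]row4_surj strip_cubical_row4 ht1_row4 ht2_row4. Qed.

Lemma strip_canonicalE v : strip D canonical v <->
  [/\ 0 <= ht1 v <= 1 + a, 0 <= ht2 v <= 2 + b & - (a * (1 + b)) <= ht1 v - a * ht2 v <= 1].
Proof. by rewrite [v]row4_surj strip_canonical_row4 ht1_row4 ht2_row4. Qed.

Lemma norm_height_le v (c : R) : 0 <= c -> `|ht1 v| <= c -> `|ht2 v| <= c ->
  `|height D v| <= c.
Proof.
move=> c0; rewrite [v]row4_surj height_row4 ht1_row4 ht2_row4 => h1 h2.
by apply: norm_le_coord => // -[[|[|//]] ?]; rewrite mxE.
Qed.

Lemma int_odd_neq0 (k : int) : 1 + 2 * k != 0.
Proof. by apply/eqP => /(congr1 (fun t => (t %% 2)%Z)); rewrite addrC mulrC modzMDl. Qed.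

(** Twice such an equality is an integer relation between 1 and sqrt2 whose constant term is odd. *)
Lemma shifted_ht1_neq v (k l : int) : shifted_lattice D v ->
  ht1 v != k%:~R + a * l%:~R.
Proof.
move=> /shifted_row4P[p1 [p2 [q1 [q2 ->]]]]; rewrite ht1_row4; apply/eqP => e.
have [|] := @sqrt2_irrational R (1 + 2 * (q1 - k)) (2 * (p1 - l)).
  by rewrite !(intrD, intrM, rmorphN)/=; lra.
by move/eqP; rewrite (negPf (int_odd_neq0 _)).
Qed.

Lemma shifted_ht2_neq v (k l : int) : shifted_lattice D v ->
  ht2 v != k%:~R + b * l%:~R.
Proof.
move=> /shifted_row4P[p1 [p2 [q1 [q2 ->]]]]; rewrite ht2_row4; apply/eqP => e.
have [|] := @sqrt3_irrational R (1 + 2 * (q2 + p1 - k)) (2 * (p2 - l)).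
  by rewrite !(intrD, intrM, rmorphN)/=; lra.
by move/eqP; rewrite (negPf (int_odd_neq0 _)).
Qed.

(** In this form [p1] cancels, leaving a relation between 1, sqrt2 and sqrt6 with an odd constant
    term. *)
Lemma shifted_slanted_neq v (k l m : int) : shifted_lattice D v ->
  ht1 v - a * ht2 v != k%:~R + a * l%:~R + a * b * m%:~R.
Proof.
move=> /shifted_row4P[p1 [p2 [q1 [q2 ->]]]]; rewrite ht1_row4 ht2_row4; apply/eqP => e.
have [|] := @sqrt26_independent R (1 + 2 * (q1 - k)) (- (1 + 2 * (q2 + l)))
    (- (2 * (p2 + m))).
  by rewrite !(intrD, intrM, rmorphN)/=; lra.
by move/eqP; rewrite (negPf (int_odd_neq0 _)).
Qed.

Lemma example_regular_cubical : regular_window D cubical.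
Proof.
pose f := (ht1 \min (fun v => 1 - ht1 v)) \min (ht2 \min (fun v => 1 - ht2 v)).
have cB (g : 'rV[R]_(2 + 2) -> R) : continuous g -> continuous (fun v => 1 - g v).
  by move=> cg v; exact: (cvgB (cvg_cst (1 : R)) (cg v)).
have c1 := ht1_continuous; have c2 := ht2_continuous.
have cf : continuous f.
  move=> v; exact: (continuous_min (continuous_min (c1 v) (cB _ c1 v))
    (continuous_min (c2 v) (cB _ c2 v))).
apply: (regular_window_pos cf) => v.
- move=> /strip_cubicalE[/andP[? ?] /andP[? ?]].
  by rewrite /f /= !le_min; apply/andP; split; apply/andP; split; lra.
- rewrite /f /= !lt_min => /andP[/andP[? ?] /andP[? ?]].
  by apply/strip_cubicalE; split; apply/andP; split; lra.
move=> sv.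
have := shifted_ht1_neq 0 0 sv; have := shifted_ht1_neq 1 0 sv.
have := shifted_ht2_neq 0 0 sv; have := shifted_ht2_neq 1 0 sv.
rewrite !mulr0 !addr0 => /eqP h1 /eqP h2 /eqP h3 /eqP h4.
apply/eqP; rewrite /f /= /Num.min.
by do ![case: ifP => _] => e; first [apply: h1; lra|apply: h2; lra|apply: h3; lra|apply: h4; lra].
Qed.

Lemma example_regular_canonical : regular_window D canonical.
Proof.
pose l v := ht1 v - a * ht2 v.
pose f := ((ht1 \min (fun v => 1 + a - ht1 v)) \min (ht2 \min (fun v => 2 + b - ht2 v)))
  \min ((fun v => l v + a * (1 + b)) \min (fun v => 1 - l v)).
have cB (k : R) (g : 'rV[R]_(2 + 2) -> R) :
    continuous g -> continuous (fun v => k - g v).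
  by move=> cg v; exact: (cvgB (cvg_cst k) (cg v)).
have c1 := ht1_continuous; have c2 := ht2_continuous.
have cl : continuous l by move=> v; exact: (cvgB (c1 v) (cvgM (cvg_cst a) (c2 v))).
have clD : continuous (fun v => l v + a * (1 + b)).
  by move=> v; exact: (cvgD (cl v) (cvg_cst (a * (1 + b)))).
have cf : continuous f.
  move=> v; exact: (continuous_min (continuous_min
    (continuous_min (c1 v) (cB _ _ c1 v)) (continuous_min (c2 v) (cB _ _ c2 v)))
    (continuous_min (clD v) (cB _ _ cl v))).
apply: (regular_window_pos cf) => v.
- move=> /strip_canonicalE[/andP[? ?] /andP[? ?] /andP[? ?]].
  by rewrite /f /= !le_min /l; repeat (apply/andP; split); lra.
- rewrite /f /= !lt_min /l => /andP[/andP[/andP[? ?] /andP[? ?]] /andP[? ?]].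
  by apply/strip_canonicalE; split; apply/andP; split; lra.
move=> sv.
(* One instance for each side of the hexagon; [f] is the least of the six slacks. *)
have := shifted_ht1_neq 0 0 sv; have := shifted_ht1_neq 1 1 sv.
have := shifted_ht2_neq 0 0 sv; have := shifted_ht2_neq 2 1 sv.
have := shifted_slanted_neq 0 (- 1) (- 1) sv; have := shifted_slanted_neq 1 0 0 sv.
rewrite !rmorphN /= !mulr0 !addr0 !mulr1.
move=> /eqP h1 /eqP h2 /eqP h3 /eqP h4 /eqP h5 /eqP h6.
apply/eqP; rewrite /f /l /= /Num.min.
by do ![case: ifP => _] => e; first [apply: h1; lra|apply: h2; lra|apply: h3; lra
  |apply: h4; lra|apply: h5; lra|apply: h6; lra].
Qed.

(** A lattice translate of a point of E can match the first two coordinates of [v] exactly. Then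
    [p1], [q1] bring the third one close, and [p2], [q2] the fourth, which depends on [p1] as
    well. *)
Lemma example_totally_irrational : totally_irrational D.
Proof.
move=> O [w Ow] oO.
have [v vw] : exists v, torus_proj v = w by exists (repr w); exact: reprK.
have : nbhs v (@torus_proj R (2 + 2) @^-1` O).
  by apply: open_nbhs_nbhs; split => //=; rewrite vw.
move=> /nbhs_ballP[e /= e0 eO].
pose v1 := v 0 (lshift 2 0); pose v2 := v 0 (lshift 2 1).
pose v3 := v 0 (rshift 2 0); pose v4 := v 0 (rshift 2 1).
have [p1 [q1 /andP[h1 h2]]] :=
  badly_approximable_dense1 sqrt2_badly_approximable (- (a * v1)) v3 e0.
have [p2 [q2 /andP[h3 h4]]] :=
  badly_approximable_dense1 sqrt3_badly_approximable (- (v1 - p1%:~R + b * v2)) v4 e0.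
pose y1 := v1 - p1%:~R; pose y2 := v2 - p2%:~R.
pose y := row4 y1 y2 (- (a * y1)) (- (y1 + b * y2)).
pose n : 'rV[R]_(2 + 2) := row4 p1%:~R p2%:~R q1%:~R q2%:~R.
exists (torus_proj y); split; last by exists y => //; exact: row4_phys.
have -> : torus_proj y = torus_proj (y + n).
  apply/torus_projP; rewrite opprD addrA subrr add0r => i; rewrite mxE rpredN.
  by move: i; apply/int_row4P; do 4 eexists.
have vE : v = row4 v1 v2 v3 v4 by rewrite {1}[v]row4_surj !mxE.
have close i : `|(v - (y + n)) 0 i| < e.
  move: i; rewrite /y /n {1}vE !(row4D, row4N).
  by apply/(forall_row4 (fun t => `|t| < e)); split; rewrite /y1 /y2 ltr_norml;
    apply/andP; split; lra.
apply: eO; split => // i j; rewrite ord1 /ball/=.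
by have := close j; rewrite mxE [(- (y + n)) _ _]mxE.
Qed.

End ExampleProperties.

(** * Linear repetitivity of the cubical set *)

Section ExampleRepetitivity.
Context {R : realType}.

Notation a := (Num.sqrt (2%:R : R)).
Notation b := (Num.sqrt (3%:R : R)).
Notation D := (@example R).
Notation cubical := (cubical_window R 2 2).
Notation canonical := (canonical_window D).

Lemma mulrn_bounded_eq0 (x y : R) : (forall i : nat, 0 <= x + y *+ i < 1) -> y = 0.
Proof.
move=> H; apply/eqP; rewrite -normr_eq0 eq_le normr_ge0 andbT leNgt.
apply/negP => y0; pose i := Num.bound `|y|^-1.
have h : `|y|^-1 < i%:R by rewrite archi_boundP// invr_ge0 ltW.
have h1 : 1 < `|y| * i%:R by rewrite mulrC -ltr_pdivrMr// div1r.
have := H i; have := H 0%N; rewrite mulr0n addr0 -mulr_natr.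
have i0 : 0 <= i%:R :> R by apply: ler0n.
move=> /andP[? ?] /andP[? ?].
have : `|y * i%:R| < 1 by rewrite ltr_norml; apply/andP; split; lra.
by rewrite normrM (ger0_norm i0); lra.
Qed.

(** A period lifts to a lattice vector [n] all of whose multiples, added to [z], stay in the strip.
    Boundedness forces the height of [n] to vanish, and irrationality then forces [n = 0]. *)
Lemma example_aperiodic : aperiodic D cubical.
Proof.
move=> x xE eqY.
pose z : 'rV[R]_(2 + 2) := row4 0 0 (1 / 2) (1 / 2).
have sz : shifted_lattice D z by apply/shifted_row4P; exists 0, 0, 0, 0; rewrite !add0r.
have zS : strip D cubical z.
  by apply/strip_cubicalE; rewrite ht1_row4 ht2_row4; split; apply/andP; split; lra.
have iter (i : nat) : cp_set D cubical (proj_pi D z + x *+ i).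
  elim: i => [|i IHi]; first by rewrite mulr0n addr0; exists z.
  by rewrite -eqY; exists (proj_pi D z + x *+ i) => //; rewrite mulrSr addrA.
have [z1 [S1 s1] e1] : cp_set D cubical (proj_pi D z + x) by have := iter 1%N; rewrite mulr1n.
have nZ := shifted_latticeB s1 sz; set n := z1 - z in nZ.
have nx : proj_pi D n = x by rewrite /n linearB/= e1 addrAC subrr add0r.
have Sn (i : nat) : strip D cubical (z + n *+ i).
  have sn : shifted_lattice D (z + n *+ i).
    apply/(shifted_latticeD _ sz) => j; rewrite mulmxnE.
    by rewrite rpredMn.
  by apply/(cp_set_proj _ sn); rewrite linearD linearMn/= nx.
have x1M (i : nat) : ht1 (n *+ i) = ht1 n *+ i.
  elim: i => [|i IHi]; last by rewrite !mulrS ht1D IHi.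
  by rewrite !mulr0n /ht1 !mxE; ring.
have x2M (i : nat) : ht2 (n *+ i) = ht2 n *+ i.
  elim: i => [|i IHi]; last by rewrite !mulrS ht2D IHi.
  by rewrite !mulr0n /ht2 !mxE; ring.
have n1 : ht1 n = 0.
  by apply: (@mulrn_bounded_eq0 (ht1 z)) => i; rewrite -x1M -ht1D; have /strip_cubicalE[] := Sn i.
have n2 : ht2 n = 0.
  by apply: (@mulrn_bounded_eq0 (ht2 z)) => i; rewrite -x2M -ht2D; have /strip_cubicalE[] := Sn i.
rewrite -nx; move: nZ n1 n2 => /int_row4P[p1 [p2 [q1 [q2 ->]]]].
rewrite ht1_row4 ht2_row4 => /sqrt2_irrational[-> ->]; rewrite addr0.
move=> /sqrt3_irrational[-> ->].
suff -> : row4 (0 : R) 0 0 0 = 0 by rewrite linear0.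
apply/rowP => i; rewrite [RHS]mxE; move: i.
by apply/(forall_row4 (fun t => t = 0)).
Qed.

Lemma proj_rho_row4 (p1 p2 q1 q2 : R) :
  proj_rho D (row4 p1 p2 q1 q2) = row4 p1 p2 (- (a * p1)) (- (p1 + b * p2)).
Proof. by rewrite proj_rhoE graph_row4 /row4 row_mxKl !mxE. Qed.

Lemma phys_row4 (v : 'rV[R]_(2 + 2)) : v \in phys D ->
  exists p1 p2 : R, v = row4 p1 p2 (- (a * p1)) (- (p1 + b * p2)).
Proof. by move=> /physical_spaceP[x ->]; rewrite graph_row4; do 2 eexists. Qed.

Lemma norm_row4_phys (p1 p2 c : R) : `|p1| <= c -> `|p2| <= c ->
  forall i, `|row4 p1 p2 (- (a * p1)) (- (p1 + b * p2)) 0 i| <= 3 * c.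
Proof.
move=> h1 h2; have c0 : 0 <= c by apply: le_trans h1.
have ap := sqrt2_norm_le h1; have bp := sqrt3_norm_le h2.
apply/(forall_row4 (fun t => `|t| <= 3 * c)); rewrite !normrN; split; try lra.
by apply: le_trans (ler_normD _ _) _; lra.
Qed.

(* In both coordinates of the height the cubical window sees only one badly
   approximable rotation, so the patch can be made to recur in the two
   coordinates independently. *)
Lemma example_cubical_repetitive Omega : patch_shape D Omega ->
  linearly_repetitive D cubical Omega.
Proof.
move=> shape.
have [M0 M00 OM0] := patch_shape_bounded shape.
pose M := M0 + 1; have M1 : 1 <= M by rewrite /M; lra.
have [K1 K10 ret1] := badly_approximable_return (@sqrt2_badly_approximable R).
have [K2 K20 ret2] := badly_approximable_return (@sqrt3_badly_approximable R).
have [K K0 dist] := proj_pi_rho_dist D.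
pose c := (K1 + K2) * M + K; have c0 : 0 < c by rewrite /c; nra.
(* The coordinates of the displacement will be at most [3 * (c * r)], so its Euclidean norm is at
   most [12 * (c * r)], less than the radius [13 * (c * r)]. *)
exists (26 * c); first by rewrite mulr_gt0.
move=> r y r1 yY x xE.
have [S sz <-] := lattice_liftP yY; set z := lattice_lift _ _ _ in S sz *.
have [X1 [X2 xX]] := phys_row4 xE.
have [P1 [P2 [Q1 [Q2 zE]]]] := (shifted_row4P _).1 sz.
have B1 : 1 <= M * r by nra.
have [j1 [k1 [/andP[u1 v1] pat1]]] := ret1 (M * r) (ht1 z) (X1 - P1%:~R) B1.
have [j2 [k2 [/andP[u2 v2] pat2]]] := ret2 (M * r) (ht2 z) (X2 - P2%:~R) B1.
(* The last entry compensates for the [p1] in [ht2], so the two return vectors act on separate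
   heights. *)
pose n : 'rV[R]_(2 + 2) := row4 j1%:~R j2%:~R k1%:~R (k2 - j1)%:~R.
have nZ : int_lattice R (2 + 2) n by apply/int_row4P; do 4 eexists.
pose z' := z + n.
have sz' : shifted_lattice D z' by apply/shifted_latticeD.
have x1z' : ht1 z' = ht1 z + (k1%:~R + a * j1%:~R) by rewrite ht1D ht1_row4.
have x2z' : ht2 z' = ht2 z + (k2%:~R + b * j2%:~R).
  by rewrite ht2D ht2_row4 intrB; ring.
have pat (p1 p2 q1 q2 : int) : `|p1%:~R| <= M * r -> `|p2%:~R| <= M * r ->
    let w : 'rV[R]_(2 + 2) := row4 p1%:~R p2%:~R q1%:~R q2%:~R in
    strip D cubical (z' + w) <-> strip D cubical (z + w).
  move=> h1 h2 w; rewrite !strip_cubicalE !(ht1D _ w) !(ht2D _ w) x1z' x2z' /w ht1_row4 ht2_row4.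
  by rewrite -(pat1 p1 q1 h1); have := pat2 p2 (q2 + p1) h2; rewrite intrD => ->.
have S' : strip D cubical z'.
  have MR : `|0%:~R| <= M * r by rewrite normr0; lra.
  have := pat 0 0 0 0 MR MR; rewrite /=.
  have -> : row4 (0%:~R : R) 0%:~R 0%:~R 0%:~R = 0.
    apply/rowP => i; rewrite [RHS]mxE; move: i.
    by apply/(forall_row4 (fun t => t = 0)).
  by rewrite !addr0 => ->.
exists (proj_pi D z'); split; first exact/cp_set_proj.
  split; first exact: proj_pi_phys.
  have : proj_pi D z' - x \in phys D by rewrite memvB// proj_pi_phys.
  move=> /phys_row4[t1 [t2 tE]].
  have := dist z'; set g := _ - proj_rho D z'.
  have hz' : `|height D z'| <= 1.
    have /strip_cubicalE[/andP[? ?] /andP[? ?]] := S'.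
    by apply: norm_height_le => //; rewrite ger0_norm//; lra.
  move=> gK; have {}gK : `|g| <= K by apply: le_trans gK _; rewrite ler_piMr// ltW.
  have gE : g = row4 t1 t2 (- (a * t1)) (- (t1 + b * t2)) +
      row4 X1 X2 (- (a * X1)) (- (X1 + b * X2)) - proj_rho D z'.
    by rewrite -tE -xX subrK.
  have z'E : z' = row4 (P1%:~R + j1%:~R) (P2%:~R + j2%:~R)
      (Q1%:~R + 1 / 2 + k1%:~R) (Q2%:~R + 1 / 2 + (k2 - j1)%:~R).
    by rewrite /z' zE /n row4D.
  rewrite z'E proj_rho_row4 row4N !row4D in gE.
  have : forall i, `|g 0 i| <= K by move=> i; apply: le_trans gK; exact: coord_norm_le.
  rewrite gE => /(forall_row4 (fun t => `|t| <= K))[].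
  rewrite !ler_norml => /andP[g1 g2] /andP[g3 g4] _ _.
  have cr : (K1 + K2) * M * r + K <= c * r by rewrite /c; nra.
  have KM1 : 0 <= K1 * (M * r) by clear -K10 B1; apply: mulr_ge0; [exact: ltW|lra].
  have KM2 : 0 <= K2 * (M * r) by clear -K20 B1; apply: mulr_ge0; [exact: ltW|lra].
  have T1 : `|t1| <= c * r.
    by clear -g1 g2 u1 v1 cr KM1 KM2; rewrite ler_norml; apply/andP; split; lra.
  have T2 : `|t2| <= c * r.
    by clear -g3 g4 u2 v2 cr KM1 KM2; rewrite ler_norml; apply/andP; split; lra.
  have cr0 : 0 < c * r by clear -c0 r1; apply: mulr_gt0 => //; lra.
  rewrite tE; apply: (@le_lt_trans _ _ ((2 + 2)%:R * (3 * (c * r)))).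
    by apply: euclidean_norm_le; [lra|exact: norm_row4_phys].
  by clear -cr0; rewrite natrD; lra.
apply/patch_equivP => // w /int_row4P[p1 [p2 [q1 [q2 ->]]]] [u Ou].
rewrite proj_rho_row4 => ue.
have : forall i, `|(r *: u) 0 i| <= M * r.
  move=> i; rewrite mxE normrM ger0_norm; last lra.
  by rewrite mulrC ler_wpM2r//; [lra|apply: le_trans (OM0 _ _ Ou) _; rewrite /M; lra].
rewrite ue => /(forall_row4 (fun t => `|t| <= M * r))[h1 h2 _ _].
exact: pat.
Qed.

End ExampleRepetitivity.

(** * Failure of repetitivity for the canonical set *)

Section ExampleCanonical.
Context {R : realType}.

Notation a := (Num.sqrt (2%:R : R)).
Notation b := (Num.sqrt (3%:R : R)).
Notation D := (@example R).
Notation canonical := (canonical_window D).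

Lemma shifted_lattice_near (t1 t2 e : R) : 0 < e -> exists2 z,
  shifted_lattice D z & t1 < ht1 z < t1 + e /\ t2 < ht2 z < t2 + e.
Proof.
move=> e0.
have [p1 [q1 h1]] := badly_approximable_dense1 sqrt2_badly_approximable (1 / 2) t1 e0.
have [p2 [q2 h2]] := badly_approximable_dense1 sqrt3_badly_approximable (1 / 2 + p1%:~R) t2 e0.
exists (row4 p1%:~R p2%:~R (q1%:~R + 1 / 2) (q2%:~R + 1 / 2)).
  by apply/shifted_row4P; do 4 eexists.
by rewrite ht1_row4 ht2_row4 [q1%:~R + _]addrC [q2%:~R + _]addrC [_ + q2%:~R + _]addrAC.
Qed.

(* The triangle bounded by the lines [ht1 = 0], [ht2 = 1] and
   [ht1 - a (ht2 - 1) = s], where [s < N^-2] comes from an integer relation of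
   size [N]; each of the three lines supports a translate of the canonical
   window by a lattice vector of size [O(N)]. *)
Lemma thin_patch (N : nat) : (0 < N)%N ->
  exists (s : R) (n1 n2 : 'rV[R]_(2 + 2)) z,
  [/\ 0 < s < (N%:R ^+ 2)^-1,
      [/\ int_lattice R (2 + 2) n1, int_lattice R (2 + 2) n2,
          forall i, `|proj_rho D n1 0 i| <= 27 * N%:R &
          forall i, `|proj_rho D n2 0 i| <= 27 * N%:R],
      [/\ shifted_lattice D z, strip D canonical z,
          strip D canonical (z + n1) & strip D canonical (z + n2)] &
      forall z', strip D canonical z' -> strip D canonical (z' + n1) ->
        strip D canonical (z' + n2) -> 0 <= ht1 z' <= s /\ 0 <= ht2 z' <= 1].
Proof.
move=> N0; have N1 : 1 <= N%:R :> R by rewrite ler1n.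
have a1 := @sqrt2_ge1 R; have a2 := @sqrt2_le2 R.
have b1 := @sqrt3_ge1 R; have b2 := @sqrt3_le2 R.
have [A [B [C [BN CN /andP[s0 sN]]]]] := @small_relation R N N0.
set s := _ + a * b * _ in s0 sN.
have N2 : (N%:R ^+ 2)^-1 <= 1 :> R by rewrite invf_le1 ?exprn_gt0 ?exprn_ege1//; lra.
(* The slanted form does not involve [p1], so [P] is free to put [ht1 n2] between 1 and [1 + a]. *)
pose P := Num.ceil (A%:~R / a).
have [P0 P1] : 0 <= - A%:~R + a * P%:~R /\ - A%:~R + a * P%:~R < a.
  have a0 : 0 < a by lra.
  have /andP[] := ceil_itv (A%:~R / a).
  by rewrite -/P intrB ltr_pdivlMr// ler_pdivrMr//; lra.
(* Membership of [z + n1] forces [ht2 z <= 1], since [ht2 n1 = 1 + b]. The slanted value [1 + a - s]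
   of [n2] forces [ht1 z + a * (1 - ht2 z) <= s]. *)
pose n1 : 'rV[R]_(2 + 2) := row4 1%:~R 1%:~R 0%:~R 0%:~R.
pose n2 : 'rV[R]_(2 + 2) := row4 P%:~R C%:~R (1 - A)%:~R (B - 1)%:~R.
exists s, n1, n2.
have x1n1 : ht1 n1 = a by rewrite ht1_row4; ring.
have x2n1 : ht2 n1 = 1 + b by rewrite ht2_row4; ring.
have x1n2 : ht1 n2 = 1 + (- A%:~R + a * P%:~R) by rewrite ht1_row4 intrB; ring.
have ln2 : ht1 n2 - a * ht2 n2 = 1 + a - s.
  by rewrite ht1_row4 ht2_row4 !intrB /s; ring.
(* A point near the corner [(0, 1)], inside the triangle as [s / 4 + a * (s / 4) < s]. The second
   bound on [ht1 z] keeps [ht1 (z + n2)] below [1 + a]. *)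
have [z sz [/andP[z1 z1'] /andP[z2 z2']]] :
    exists2 z, shifted_lattice D z & 0 < ht1 z < Num.min (s / 4) (a - (- A%:~R + a * P%:~R))
      /\ 1 - s / 4 < ht2 z < 1.
  pose e := Num.min (s / 4) (a - (- A%:~R + a * P%:~R)).
  have e0 : 0 < e by rewrite lt_min; apply/andP; split; lra.
  have [z sz [h1 h2]] := shifted_lattice_near 0 (1 - e) e0.
  have es : e <= s / 4 by rewrite ge_min lexx.
  exists z => //; split; first by rewrite add0r in h1.
  by move: h2 => /andP[? ?]; apply/andP; split; lra.
move: z1'; rewrite lt_min => /andP[z1' z1''].
exists z; split.
- by rewrite s0.
- split.
  + by apply/int_row4P; do 4 eexists.
  + by apply/int_row4P; do 4 eexists.
  + rewrite proj_rho_row4 => i; apply: le_trans (norm_row4_phys (c := 1) _ _ i) _;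
      rewrite ?normr1//; lra.
  (* The relation gives [|A| <= 7 N], hence [|P| <= |a P| <= 7 N + 2 <= 9 N]. *)
  rewrite proj_rho_row4 => i; apply: le_trans (norm_row4_phys (c := 9 * N%:R) _ _ i) _; last lra.
    have aB := sqrt2_norm_le BN; have abC := sqrt2_norm_le (sqrt3_norm_le CN).
    rewrite ler_norml in aB; rewrite ler_norml in abC.
    move: aB abC => /andP[? ?] /andP[? ?].
    have AN : - (7 * N%:R) <= (A%:~R : R) <= 7 * N%:R.
      by rewrite /s in s0 sN; apply/andP; split; lra.
    have aP : `|P%:~R : R| <= `|a * P%:~R|.
      by rewrite normrM ler_peMl// ger0_norm ?sqrtr_ge0.
    apply: le_trans aP _; move: AN => /andP[? ?].
    by rewrite ler_norml; apply/andP; split; lra.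
  by apply: le_trans CN _; lra.
- split => //; apply/strip_canonicalE.
  + by split; apply/andP; split; nra.
  + by rewrite ht1D ht2D x1n1 x2n1; split; apply/andP; split; nra.
  + rewrite ht1D ht2D.
    have w0 : 0 <= a * (1 - ht2 z) by apply: mulr_ge0; lra.
    have w1 : a * (1 - ht2 z) <= s / 2 by nra.
    have X0 : 0 <= a * (ht2 z + ht2 n2) by lra.
    have ab : a <= a * b by rewrite ler_peMr//; lra.
    have X1 : a * (ht2 z + ht2 n2) <= a * (2 + b) by lra.
    have a0 : 0 < a by lra.
    rewrite pmulr_rge0// in X0; rewrite ler_pM2l// in X1.
    by split; apply/andP; split; lra.
move=> z' /strip_canonicalE[/andP[h1 _] /andP[h2 _] _].
move=> /strip_canonicalE[_ + _]; rewrite ht2D x2n1 => /andP[_ h3].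
move=> /strip_canonicalE[_ _]; rewrite ht1D ht2D => /andP[_ h4].
have h5 : ht2 z' <= 1 by clear -h3; lra.
have h6 : 0 <= a * (1 - ht2 z') by rewrite mulr_ge0 ?sqrtr_ge0 ?subr_ge0.
by rewrite h1 h2 h5 andbT; split=> //; clear -h4 h6 ln2; lra.
Qed.

Lemma proj_pi_coord_close : exists2 K : R, 0 < K & forall z i,
  `|ht1 z| <= 1 -> `|ht2 z| <= 1 ->
  `|proj_pi D z 0 (lshift 2 i) - z 0 (lshift 2 i)| <= K.
Proof.
have [K K0 dist] := proj_pi_rho_dist D.
exists K => // z i h1 h2.
have hz : `|height D z| <= 1 by apply: norm_height_le.
have -> : z 0 (lshift 2 i) = proj_rho D z 0 (lshift 2 i).
  by rewrite proj_rhoE row_mxEl mxE.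
have -> : proj_pi D z 0 (lshift 2 i) - proj_rho D z 0 (lshift 2 i) =
  (proj_pi D z - proj_rho D z) 0 (lshift 2 i) by rewrite [RHS]mxE [X in _ = _ + X]mxE.
apply: le_trans (coord_norm_le _ _) _.
by apply: le_trans (dist z) _; rewrite ler_piMr// ltW.
Qed.

(* Two occurrences of a thin patch whose first coordinates differ by [O(N)]
   would give an integer combination of 1 and [sqrt2] of size at most
   [N^-2]. *)
Lemma example_canonical_not_repetitive Omega : patch_shape D Omega ->
  ~ linearly_repetitive D canonical Omega.
Proof.
move=> shape [C C0 rep].
have [e e0 eO] := patch_shape_nbhs0 shape.
have [K K0 close] := proj_pi_coord_close.
have [c c0 bad] := @sqrt2_badly_approximable R.
(* With [r = kappa * N] one has [e * r > 27 * N], so both vectors of the thin patch have their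
   projections in [r Omega]. *)
pose kappa := 28 / e + 1.
have kappa0 : 0 < 28 / e by rewrite divr_gt0.
(* Large enough that the bound [(2 * C * kappa + 4 * K + 1) * N] on the shift [p1] is below
   [c * N^2]. *)
pose N := (Num.bound ((2 * C * kappa + 4 * K + 1) / c)).+1.
have N1 : 1 <= N%:R :> R by rewrite ler1n.
have NB : (2 * C * kappa + 4 * K + 1) / c < N%:R.
  apply: (@lt_trans _ _ (Num.bound ((2 * C * kappa + 4 * K + 1) / c))%:R).
    apply: archi_boundP; rewrite divr_ge0 ?(ltW c0)//.
    have : 0 <= 2 * C * kappa by rewrite /kappa !mulr_ge0//; lra.
    by lra.
  by rewrite ltr_nat.
rewrite ltr_pdivrMr// in NB.
have [//|s [n1 [n2 [z [/andP[s0 sN] [n1Z n2Z b1 b2] [sz S S1 S2] thin]]]]] := @thin_patch N.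
have s1 : s <= 1.
  by apply/ltW/(lt_le_trans sN); rewrite invf_le1 ?exprn_gt0 ?exprn_ege1//; lra.
pose r := kappa * N%:R.
have r1 : 1 <= r by rewrite /r /kappa; nra.
have nO n : (forall i, `|proj_rho D n 0 i| <= 27 * N%:R) ->
    [set r *: u | u in Omega] (proj_rho D n).
  move=> nb; have r0 : 0 < r by lra.
  exists (r^-1 *: proj_rho D n); last by rewrite scalerA divff ?scale1r// gt_eqF.
  apply: eO; first by rewrite memvZ// proj_rhoE graph_map_phys.
  move=> i; rewrite mxE normrM gtr0_norm ?invr_gt0// mulrC ltr_pdivrMr//.
  apply: le_lt_trans (nb i) _.
  have -> : e * r = 28 * N%:R + e * N%:R by rewrite /r /kappa; field; rewrite gt_eqF.
  have : 0 < e * N%:R by rewrite mulr_gt0//; lra.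
  lra.
have yY : cp_set D canonical (proj_pi D z) by apply/cp_set_proj.
have occ (X : R) : exists2 w, shifted_lattice D w &
    [/\ 0 <= ht1 w <= s, - (C * r / 2 + K) <= w 0 (lshift 2 0) - X &
        w 0 (lshift 2 0) - X <= C * r / 2 + K].
  have XE : row4 X 0 (- (a * X)) (- (X + b * 0)) \in phys D by exact: row4_phys.
  have [y' [y'Y [y'E y'X] eqv]] := rep r _ r1 yY _ XE.
  have [T tw tE] := lattice_liftP y'Y; set w := lattice_lift _ _ _ in T tw tE.
  rewrite -tE in eqv y'X.
  have {}eqv := (patch_equivP _ _ tw sz T S).1 eqv.
  have T1 : strip D canonical (w + n1) by apply/eqv => //; exact: nO.
  have T2 : strip D canonical (w + n2) by apply/eqv => //; exact: nO.
  have [w1 /andP[w2 w2']] := thin _ T T1 T2.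
  move: (w1) => /andP[w3 w3'].
  exists w => //.
  have x1w : `|ht1 w| <= 1 by rewrite ger0_norm// (le_trans w3').
  have x2w : `|ht2 w| <= 1 by rewrite ger0_norm.
  have := close w 0 x1w x2w.
  have := le_lt_trans (coord_euclidean_norm_le _ (lshift 2 0)) y'X.
  rewrite mxE [(- row4 _ _ _ _) _ _]mxE [row4 _ _ _ _ _ _]row_mxEl mxE/=.
  rewrite ltr_norml ler_norml => /andP[e1 e2] /andP[e3 e4].
  by split => //; clear -e1 e2 e3 e4; lra.
have [w sw [/andP[w1 w2] w3 w4]] := occ 0.
(* Each occurrence lies within [C * r / 2 + K] of its target, so this target makes the first
   coordinates differ by at least 1. *)
have [v sv [/andP[v1 v2] v3 v4]] := occ (C * r + 2 * K + 1).
have /int_row4P[p1 [p2 [q1 [q2 E]]]] := shifted_latticeB sv sw.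
have pE : v 0 (lshift 2 0) - w 0 (lshift 2 0) = p1%:~R.
  have := congr1 (fun u : 'rV[R]_(2 + 2) => u 0 (lshift 2 0)) E.
  by rewrite mxE [(- w) _ _]mxE row_mxEl mxE.
have xE : ht1 v - ht1 w = q1%:~R + a * p1%:~R.
  rewrite -(ht1_row4 _ p2%:~R _ q2%:~R) -E.
  by rewrite /ht1 !mxE; ring.
have p1gt : 1 <= (p1%:~R : R) by clear -pE v3 w4; lra.
have p10 : p1 != 0 by apply: contraTneq p1gt => ->; rewrite -ltNge ltr01.
have p1le : p1%:~R <= 2 * (C * r) + 4 * K + 1 by clear -pE v4 w3; lra.
have p1ge0 : 0 <= (p1%:~R : R) := le_trans ler01 p1gt.
have := bad p1 q1 p10; rewrite -xE (ger0_norm p1ge0).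
have d1 : `|ht1 v - ht1 w| <= s.
  by clear -v1 v2 w1 w2; rewrite ler_norml; apply/andP; split; lra.
move=> h.
have pN : p1%:~R <= (2 * C * kappa + 4 * K + 1) * N%:R.
  apply: le_trans p1le _; rewrite /r.
  clear -K0 N1; have : 0 <= (4 * K + 1) * (N%:R - 1) by apply: mulr_ge0; lra.
  by lra.
have h2 : c <= p1%:~R * s by apply: le_trans h _; rewrite ler_wpM2l//; lra.
have h3 : p1%:~R * s < p1%:~R * (N%:R ^+ 2)^-1.
  by clear -p1gt sN; rewrite ltr_pM2l//; lra.
have h4 : p1%:~R * (N%:R ^+ 2)^-1 <= c.
  have N2 : 0 < N%:R ^+ 2 :> R by rewrite exprn_gt0//; lra.
  rewrite ler_pdivrMr//; apply: le_trans pN _; rewrite expr2 mulrA.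
  by clear -NB N1; apply: ler_wpM2r; lra.
by have := le_lt_trans h2 (lt_le_trans h3 h4); rewrite ltxx.
Qed.

End ExampleCanonical.

Theorem theorem1p2 (R : realType) :
  (forall (d m : nat) (D : cut_and_project_data R d m)
     (Omega : set 'rV[R]_(d + m)),
     patch_shape D Omega ->
     is_cubical D ->
     regular_window D (canonical_window D) ->
     ~ linearly_repetitive D (cubical_window R d m) Omega ->
     ~ linearly_repetitive D (canonical_window D) Omega) /\
  (exists (d m : nat) (D : cut_and_project_data R d m),
     is_cubical D /\
     regular_window D (canonical_window D) /\
     (forall Omega : set 'rV[R]_(d + m),
        patch_shape D Omega ->
        linearly_repetitive D (cubical_window R d m) Omega /\
        ~ linearly_repetitive D (canonical_window D) Omega)).
Proof.
split=> [d m D Omega shape [reg _ _] _ nrep rep|].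
  exact/nrep/linearly_repetitive_cubical.
exists 2, 2, (@example R); split.
  split; [exact: example_regular_cubical|exact: example_totally_irrational|].
  exact: example_aperiodic.
split=> [|Omega shape]; first exact: example_regular_canonical.
split; first exact: example_cubical_repetitive.
exact: example_canonical_not_repetitive.
Qed.
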